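(* Let $\Omega\subseteq\mathbb{R}^n$ be a nonempty open set, $s\in\mathbb{R}$, $1<p<\infty$, and let $(s,p,\Omega)$ be an interior smooth multiplication triple. Then $W^{s,p}_{loc}(\Omega)$ is metrizable. Indeed, if $A=\{\varphi_j\}_{j=1}^\infty$ is a countable admissible family, then $$d(u,v)=\sum_{j=1}^\infty\frac{1}{2^j}\frac{|u-v|_{\varphi_j}}{1+|u-v|_{\varphi_j}}$$ is a translation invariant metric on $W^{s,p}_{loc}(\Omega)$ compatible with its topology.
   Context: All functions are real-valued. $C_c^\infty(\Omega)$ is the set of smooth functions with compact support in $\Omega$; $D'(\Omega)$ is the space of distributions on $\Omega$. Let $\frac1p+\frac1{p'}=1$. Sobolev-Slobodeckij spaces: for $k\in\mathbb{N}_0$, $W^{k,p}(\Omega)=\{u\in L^p(\Omega):\|u\|_{W^{k,p}(\Omega)}:=\sum_{|\nu|\le k}\|\partial^\nu u\|_{L^p(\Omega)}<\infty\}$; for $0<\theta<1$, $|u|_{W^{\theta,p}(\Omega)}:=\big(\iint_{\Omega\times\Omega}\frac{|u(x)-u(y)|^p}{|x-y|^{n+\theta p}}dx\,dy\big)^{1/p}$; for $s=k+\theta$ with $k\in\mathbb{N}_0$, $0<\theta<1$, $W^{s,p}(\Omega)=\{u\in W^{k,p}(\Omega):\|u\|_{W^{s,p}(\Omega)}:=\|u\|_{W^{k,p}(\Omega)}+\sum_{|\nu|=k}|\partial^\nu u|_{W^{\theta,p}(\Omega)}<\infty\}$. $W^{s,p}_0(\Omega)$ is the closure of $C_c^\infty(\Omega)$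 in $W^{s,p}(\Omega)$. For $s<0$, $W^{s,p}(\Omega)=(W^{-s,p'}_0(\Omega))^*$ with the dual norm, viewed as a subspace of $D'(\Omega)$ by restricting functionals to $C_c^\infty(\Omega)$. For compact $K\subseteq\Omega$, $W^{s,p}_K(\Omega)=\{u\in W^{s,p}(\Omega):\mathrm{supp}\,u\subseteq K\}$ with the norm of $W^{s,p}(\Omega)$. $W^{s,p}_{loc}(\Omega)=\{u\in D'(\Omega):\varphi u\in W^{s,p}(\Omega)\ \forall\varphi\in C_c^\infty(\Omega)\}$, equipped with the topology induced by the seminorms $|u|_\varphi:=\|\varphi u\|_{W^{s,p}(\Omega)}$, $\varphi\in C_c^\infty(\Omega)$. $(s,p,\Omega)$ is an interior smooth multiplication triple if for all $\varphi\in C_c^\infty(\Omega)$ and compact $K\subseteq\Omega$ the map $u\mapsto\varphi u$ is well-defined and bounded from $W^{s,p}_K(\Omega)$ to $W^{s,p}_K(\Omega)$. A subset $A\subseteq C_c^\infty(\Omega)$ is an admissible family if for every $x\in\Omega$ there is $\varphi\in A$ with $\varphi\ge0$ and $\varphi(x)\ne0$. *)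

(* Defs.v *)
From HB Require Import structures.
From mathcomp Require Import all_boot all_order all_algebra.
From mathcomp Require Import all_classical all_reals all_analysis.
Import Order.TTheory GRing.Theory Num.Theory.
Import numFieldNormedType.Exports.

Set Implicit Arguments.
Unset Strict Implicit.
Unset Printing Implicit Defensive.

Local Open Scope classical_set_scope.
Local Open Scope ring_scope.

Definition rV_display : measure_display.
Proof. exact: default_measure_display. Qed.

Section rV_measurable.
Context {R : realType} {n : nat}.

Definition rV_coord (i : 'I_n) (x : 'rV[R]_n) : measurableTypeR R := x 0 i.

Let rV_set0 : g_sigma_preimage rV_coord set0.
Proof. exact: sigma_algebra0. Qed.

Let rV_setC A : g_sigma_preimage rV_coord A -> g_sigma_preimage rV_coord (~` A).
Proof. exact: sigma_algebraC. Qed.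

Let rV_bigcup (F : _^nat) : (forall i, g_sigma_preimage rV_coord (F i)) ->
  g_sigma_preimage rV_coord (\bigcup_i (F i)).
Proof. exact: sigma_algebra_bigcup. Qed.

(* The product sigma-algebra, i.e. the Borel sets of R^n *)
HB.instance Definition _ := @isMeasurable.Build rV_display
  'rV[R]_n (g_sigma_preimage rV_coord) rV_set0 rV_setC rV_bigcup.

Lemma measurable_rV_coord i : measurable_fun [set: 'rV[R]_n] (rV_coord i).
Proof.
move=> _ Y mY; rewrite setTI; apply: sub_sigma_algebra => /=.
rewrite -bigcup_seq/=; exists i => /=; first by rewrite mem_index_enum.
by exists Y => //; rewrite setTI.
Qed.

Lemma measurable_fun_rV d (T : measurableType d) (f : T -> 'rV[R]_n) :
  (forall i, measurable_fun [set: T] (rV_coord i \o f)) ->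
  measurable_fun [set: T] f.
Proof.
move=> mf _ Y; rewrite setTI.
apply: (@smallest_sub _ _ _ [set A | measurable (f @^-1` A)]) => [|A /=].
  split=> /= [|A mA|F mF]; first by rewrite preimage_set0.
    by rewrite setTD preimage_setC; exact: measurableC.
  by rewrite preimage_bigcup; exact: bigcupT_measurable.
rewrite -bigcup_seq/= => -[i _ [B mB <-]].
by rewrite setTI -comp_preimage -[X in measurable X]setTI; exact: mf.
Qed.

End rV_measurable.

Section rV_lebesgue.
Context {R : realType}.

Definition rV_cons n (z : measurableTypeR R * 'rV[R]_n) : 'rV[R]_n.+1 :=
  \row_i oapp (fun j => z.2 0 j) z.1 (unlift ord0 i).

Definition rV_uncons n (x : 'rV[R]_n.+1) : measurableTypeR R * 'rV[R]_n :=
  (x 0 ord0, \row_j x 0 (lift ord0 j)).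

Lemma rV_consK n : cancel (@rV_cons n) (@rV_uncons n).
Proof.
move=> [a x]; rewrite /rV_uncons /rV_cons mxE unlift_none/=; congr pair.
by apply/rowP => j; rewrite !mxE liftK.
Qed.

Lemma rV_unconsK n : cancel (@rV_uncons n) (@rV_cons n).
Proof.
by move=> x; apply/rowP => j; rewrite mxE; case: unliftP => [k|] -> //=; rewrite mxE.
Qed.

Lemma measurable_rV_cons n : measurable_fun setT (@rV_cons n).
Proof.
apply: measurable_fun_rV => i; case: (unliftP ord0 i) => [j|] ->.
  rewrite (_ : _ \o _ = rV_coord j \o snd); last first.
    by apply/funext => z /=; rewrite /rV_coord mxE liftK.
  by apply: measurableT_comp; [exact: measurable_rV_coord|exact: measurable_snd].
rewrite (_ : _ \o _ = fst); first exact: measurable_fst.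
by apply/funext => z /=; rewrite /rV_coord mxE unlift_none.
Qed.

Lemma measurable_rV_uncons n : measurable_fun setT (@rV_uncons n).
Proof.
apply/measurable_fun_pairP; split; first exact: measurable_rV_coord.
apply: measurable_fun_rV => i.
rewrite (_ : _ \o _ = rV_coord (lift ord0 i)); first exact: measurable_rV_coord.
by apply/funext => z /=; rewrite /rV_coord mxE.
Qed.

Section step.
Variables (n : nat) (mu : {sigma_finite_measure set 'rV[R]_n -> \bar R}).

Definition rV_measureS : set 'rV[R]_n.+1 -> \bar R :=
  pushforward (lebesgue_measure \x mu)%E (@rV_cons n).

HB.instance Definition _ := Measure.copy rV_measureS
  (measure_function_pushforward__canonical__measure_function_Measure
     (lebesgue_measure \x mu)%E (@measurable_rV_cons n)).

(* The library's canonical instance for products of sigma-finite measures is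
   shadowed by the one for subprobabilities, hence this direct proof *)
Let sigma_finite_rV_measureS : sigma_finite setT rV_measureS.
Proof.
have /sigma_finiteP[F [TF ndF Foo]] :=
  sigma_finiteT (lebesgue_measure : {sigma_finite_measure set _ -> \bar R}).
have /sigma_finiteP[G [TG ndG Goo]] := sigma_finiteT mu.
exists (fun k => @rV_uncons n @^-1` (F k `*` G k)).
  apply/seteqP; split=> // x _.
  have [i _ Fi] : (\bigcup_k F k) (rV_uncons x).1 by rewrite -TF.
  have [j _ Gj] : (\bigcup_k G k) (rV_uncons x).2 by rewrite -TG.
  exists (maxn i j) => //; split.
    by move: Fi; exact/subsetPset/ndF/leq_maxl.
  by move: Gj; exact/subsetPset/ndG/leq_maxr.
move=> k; have [mF Fk] := Foo k; have [mG Gk] := Goo k; split.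
  rewrite -[X in measurable X]setTI.
  by apply: measurable_rV_uncons => //; exact: measurableX.
rewrite /rV_measureS /pushforward -comp_preimage.
rewrite (_ : _ \o _ = id); last by apply/funext => z; exact: rV_consK.
by rewrite preimage_id product_measure1E// lte_mul_pinfty// ge0_fin_numE.
Qed.

HB.instance Definition _ := Measure_isSigmaFinite.Build _ _ _
  rV_measureS sigma_finite_rV_measureS.

End step.

Fixpoint rV_lebesgue n : {sigma_finite_measure set 'rV[R]_n -> \bar R} :=
  if n is k.+1 then rV_measureS (rV_lebesgue k)
  else \d_(0 : 'rV[R]_0).

End rV_lebesgue.

Definition eucl_norm {R : realType} {n} (x : 'rV[R]_n) : R :=
  Num.sqrt (\sum_i x 0 i ^+ 2).

Section smooth.
Context {R : realType} {n : nat}.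
Implicit Types (f g : 'rV[R]_n -> R) (k : nat).

Definition partial (i : 'I_n) f : 'rV[R]_n -> R :=
  fun x => 'D_(delta_mx 0 i : 'rV[R]_n) f x.

Fixpoint Ck k f : Prop :=
  continuous f /\
  if k is k'.+1 then
    forall i, (forall x, derivable f x (delta_mx 0 i : 'rV[R]_n)) /\
              Ck k' (partial i f)
  else True.

Definition smooth f := forall k, Ck k f.

Definition supp f : set 'rV[R]_n := closure [set x | f x != 0].

Lemma Ck_continuous k f : Ck k f -> continuous f.
Proof. by case: k => [|k] []. Qed.

Lemma CkS k f : Ck k.+1 f -> Ck k f.
Proof.
elim: k f => [|k IH] f [cf fS]; first by split.
by split=> // i; have [df /IH] := fS i.
Qed.

Lemma CkD k (a : R) f g : Ck k f -> Ck k g -> Ck k (a *: f + g).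
Proof.
elim: k f g => [|k IH] f g [cf fS] [cg gS]; split=> //.
- by move=> x; apply: continuousD; [apply: continuousZl_tmp; exact: cf|exact: cg].
- by move=> x; apply: continuousD; [apply: continuousZl_tmp; exact: cf|exact: cg].
move=> i; have [df fk] := fS i; have [dg gk] := gS i; split.
  by move=> x; apply: derivableD => //; exact: derivableZ.
rewrite (_ : partial i _ = a *: partial i f + partial i g); first exact: IH.
apply/funext => x; rewrite /partial deriveD//; last exact: derivableZ.
by rewrite deriveZ.
Qed.

Lemma CkM k f g : Ck k f -> Ck k g -> Ck k (f * g).
Proof.
elim: k f g => [|k IH] f g Cf Cg.
  by split=> // x; apply: continuousM; [exact: (Ck_continuous Cf)|exact: (Ck_continuous Cg)].
split=> [x|i].
  by apply: continuousM; [exact: (Ck_continuous Cf)|exact: (Ck_continuous Cg)].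
have [_ /(_ i)[df fk]] := Cf; have [_ /(_ i)[dg gk]] := Cg; split.
  by move=> x; exact: derivableM.
rewrite (_ : partial i _ = 1 *: (f * partial i g) + g * partial i f).
  by apply: CkD; apply: IH => //; exact: CkS.
by apply/funext => x; rewrite scale1r /partial deriveM.
Qed.

Lemma Ck0 k : Ck k 0.
Proof.
have c0 : continuous (0 : 'rV[R]_n -> R) by move=> x; exact: cst_continuous.
elim: k => [|k IH]; split=> // i; split=> [x|]; first exact: derivable_cst.
by rewrite (_ : partial i 0 = 0)//; apply/funext => x; exact: derive_cst.
Qed.

Lemma supp_subset f (A : set 'rV[R]_n) :
  closed A -> (forall x, ~ A x -> f x = 0) -> supp f `<=` A.
Proof.
move=> cA fA; rewrite [A in _ `<=` A](closure_id _).1//.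
apply: closure_subset => x /= /eqP fx.
by apply: contrapT => /fA.
Qed.

Lemma supp0 f x : ~ supp f x -> f x = 0.
Proof.
by move=> nfx; apply: contrapT => /eqP fx; apply: nfx; exact: subset_closure.
Qed.

Lemma supp_partial i f : supp (partial i f) `<=` supp f.
Proof.
apply: supp_subset => [|x nfx]; first exact: closed_closure.
rewrite /partial (@near_eq_derive _ _ _ f (cst 0)) ?derive_cst//.
have : nbhs x (~` supp f).
  by apply: open_nbhs_nbhs; split => //; exact/closed_openC/closed_closure.
by apply: filterS => y; exact: supp0.
Qed.

End smooth.

Definition is_testfun {R : realType} {n} (Omega : set 'rV[R]_n)
    (f : 'rV[R]_n -> R) :=
  [/\ smooth f, compact (supp f) & supp f `<=` Omega].

(* $C_c^\infty(\Omega)$; its elements are extended by 0 to all of R^n *)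
Definition testfun_pred {R : realType} {n} (Omega : set 'rV[R]_n) :
  {pred 'rV[R]_n -> R} := [pred f | `[< is_testfun Omega f >]].

Section testfun.
Context {R : realType} {n : nat} {Omega : set 'rV[R]_n}.

Lemma is_testfun_sub (f g : 'rV[R]_n -> R) : smooth f -> is_testfun Omega g ->
  supp f `<=` supp g -> is_testfun Omega f.
Proof.
move=> sf [_ cg gO] fg; split=> //; last exact: subset_trans gO.
by apply: subclosed_compact cg fg; exact: closed_closure.
Qed.

Lemma testfun_submod : submod_closed (testfun_pred Omega).
Proof.
split=> [|a f g /asboolP[sf cf fO] /asboolP[sg cg gO]]; apply/asboolP.
  have s0 : supp (0 : 'rV[R]_n -> R) `<=` set0.
    by apply: supp_subset => //; exact: closed0.
  split; [by move=> k; exact: Ck0| |by move=> x /s0].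
  by move: s0; rewrite subset0 => ->; exact: compact0.
have sfg : supp (a *: f + g) `<=` supp f `|` supp g.
  apply: supp_subset => [|x /not_orP[fx gx]].
    by apply: closedU; exact: closed_closure.
  by rewrite (_ : _ x = a * f x + g x)// (supp0 fx) (supp0 gx) mulr0 addr0.
split; first by move=> k; exact: CkD.
  by apply: (subclosed_compact _ (compactU cf cg) sfg); exact: closed_closure.
by apply: (subset_trans sfg) => x [/fO|/gO].
Qed.

HB.instance Definition _ := GRing.isSubmodClosed.Build R ('rV[R]_n -> R)
  (testfun_pred Omega) testfun_submod.

End testfun.

Section testfun_type.
Context {R : realType} {n : nat} (Omega : set 'rV[R]_n).

Record testfun := Testfun {
  testfun_val :> 'rV[R]_n -> R;
  testfun_valP : testfun_val \in testfun_pred Omega }.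

HB.instance Definition _ := [isSub for testfun_val].
HB.instance Definition _ := [Choice of testfun by <:].
HB.instance Definition _ := [SubChoice_isSubLmodule of testfun by <:].

Lemma testfunP (phi : testfun) : is_testfun Omega phi.
Proof. exact/asboolP/testfun_valP. Qed.

Lemma testfun_mul_subproof (phi psi : testfun) :
  (phi : 'rV[R]_n -> R) * psi \in testfun_pred Omega.
Proof.
have [[sphi _ _] [spsi cpsi psiO]] := (testfunP phi, testfunP psi).
apply/asboolP/(@is_testfun_sub _ _ _ _ psi); first by move=> k; exact: CkM.
  exact: testfunP.
apply: supp_subset => [|x nx]; first exact: closed_closure.
by rewrite fctE (supp0 nx) mulr0.
Qed.

Definition testfun_mul (phi psi : testfun) : testfun :=
  Testfun (testfun_mul_subproof phi psi).

Lemma testfun_partial_subproof i (phi : testfun) :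
  partial i phi \in testfun_pred Omega.
Proof.
have [sphi _ _] := testfunP phi.
apply/asboolP/(@is_testfun_sub _ _ _ _ phi); last exact: supp_partial.
  by move=> k; have [_ /(_ i)[]] := sphi k.+1.
exact: testfunP.
Qed.

Definition testfun_partial i (phi : testfun) : testfun :=
  Testfun (testfun_partial_subproof i phi).

Definition testfun_pderiv (nu : 'I_n -> nat) (phi : testfun) : testfun :=
  foldr (fun i => iter (nu i) (testfun_partial i)) phi (enum 'I_n).

End testfun_type.

(* Multi-indices with entries at most k: a finite type that contains all the
   multi-indices of order at most k *)
Definition mindex n k := {ffun 'I_n -> 'I_k.+1}.

Definition mindex_fun n k (nu : mindex n k) : 'I_n -> nat := fun i => nu i.
Coercion mindex_fun : mindex >-> Funclass.

Definition morder n (nu : 'I_n -> nat) : nat := (\sum_i nu i)%N.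

Section distribution.
Context {R : realType} {n : nat} (Omega : set 'rV[R]_n).
Local Notation functional := (testfun Omega -> R).
Implicit Types (u v : functional) (phi psi : testfun Omega).

Definition Ck_norm k phi : R :=
  \sum_(nu : mindex n k | (morder nu <= k)%N)
    sup (range (fun x => `|testfun_pderiv nu phi x|)).

Definition is_distribution : set functional := [set u | scalar u /\
  forall K : set 'rV[R]_n, compact K -> K `<=` Omega ->
  exists C : R, exists N : nat,
    forall phi, supp phi `<=` K -> `|u phi| <= C * Ck_norm N phi].

Definition dist_pderiv (nu : 'I_n -> nat) u : functional :=
  fun phi => (-1) ^+ morder nu * u (testfun_pderiv nu phi).

Definition dist_mul phi u : functional := fun psi => u (testfun_mul phi psi).

Definition dist_supp u : set 'rV[R]_n :=
  Omega `\` \bigcup_(V in [set V | [/\ open V, V `<=` Omega &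
    forall phi, supp phi `<=` V -> u phi = 0]]) V.

Definition represents (f : 'rV[R]_n -> R) u :=
  measurable_fun Omega f /\
  forall phi, (rV_lebesgue n).-integrable Omega (EFin \o (f \* phi)) /\
    u phi = \int[rV_lebesgue n]_(x in Omega) (f x * phi x).

Definition dist_of phi : functional :=
  fun psi => \int[rV_lebesgue n]_(x in Omega) (phi x * psi x).

End distribution.

Definition slobodeckij {R : realType} {n} (Omega : set 'rV[R]_n) (theta p : R)
    (f : 'rV[R]_n -> R) : \bar R :=
  ((\int[rV_lebesgue n \x rV_lebesgue n]_(z in Omega `*` Omega)
      (`|f z.1 - f z.2| `^ p /
       eucl_norm (z.1 - z.2) `^ (n%:R + theta * p))%:E) `^ p^-1)%E.

Section sobolev.
Context {R : realType} {n : nat} (Omega : set 'rV[R]_n).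
Local Notation functional := (testfun Omega -> R).
Implicit Types (u v : functional) (s t p q theta : R).

(* A distribution has at most one representative up to a.e. equality, and the
   two quantities below do not depend on it: each infimum is the value at the
   representative, or +oo when there is none. *)
Definition dist_Lnorm p u : \bar R :=
  ereal_inf [set Lnorm (rV_lebesgue n) p%:E (EFin \o (f \_ Omega)) |
             f in [set f | represents f u]].

Definition dist_slobodeckij theta p u : \bar R :=
  ereal_inf [set slobodeckij Omega theta p f |
             f in [set f | represents f u]].

(* Meant for t >= 0, with value +oo outside of $W^{t,p}(\Omega)$ *)
Definition sobolev_pnorm t p u : \bar R :=
  let k := Num.truncn t in
  let theta := t - k%:R in
  (\sum_(nu : mindex n k | (morder nu <= k)%N) dist_Lnorm p (dist_pderiv nu u) +
   if theta == 0%R then 0 else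
   \sum_(nu : mindex n k | morder nu == k)
     dist_slobodeckij theta p (dist_pderiv nu u))%E.

Definition sobolev0 t p : set functional :=
  [set v | [/\ is_distribution v, (sobolev_pnorm t p v < +oo)%E &
    forall e : R, 0 < e ->
      exists phi, (sobolev_pnorm t p (v - dist_of phi)%R < e%:E)%E]].

Definition linear_on (V : set functional) (F : functional -> R) :=
  forall (a : R) v w, V v -> V w -> F (a *: v + w) = a * F v + F w.

Definition dual_norm t q (F : functional -> R) : \bar R :=
  ereal_sup [set `|F v|%:E |
    v in [set v | sobolev0 t q v /\ (sobolev_pnorm t q v <= 1)%E]].

(* For s < 0 the norm is that of the functional on $W^{-s,p'}_0(\Omega)$ which
   u is the restriction of; by density there is at most one continuous such
   functional, and discontinuous ones have norm +oo. *)
Definition sobolev_norm s p u : \bar R :=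
  if 0 <= s then sobolev_pnorm s p u else
  let q := p / (p - 1) in
  ereal_inf [set dual_norm (- s) q F | F in [set F |
    linear_on (sobolev0 (- s) q) F /\ forall phi, F (dist_of phi) = u phi]].

Definition sobolev s p : set functional :=
  [set u | is_distribution u /\ (sobolev_norm s p u < +oo)%E].

Definition sobolev_on (K : set 'rV[R]_n) s p : set functional :=
  [set u | sobolev s p u /\ dist_supp u `<=` K].

Definition sobolev_loc s p : set functional :=
  [set u | is_distribution u /\ forall phi, sobolev s p (dist_mul phi u)].

Definition loc_seminorm s p (phi : testfun Omega) u : R :=
  fine (sobolev_norm s p (dist_mul phi u)).

Definition interior_smooth_multiplication_triple s p :=
  forall (phi : testfun Omega) (K : set 'rV[R]_n), compact K -> K `<=` Omega ->
  (forall u, sobolev_on K s p u -> sobolev_on K s p (dist_mul phi u)) /\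
  exists C : R, forall u, sobolev_on K s p u ->
    (sobolev_norm s p (dist_mul phi u) <= C%:E * sobolev_norm s p u)%E.

Definition admissible_family (A : set (testfun Omega)) :=
  forall x, Omega x ->
    exists phi, [/\ A phi, forall y, 0 <= phi y & phi x != 0].

Definition loc_space s p : Type :=
  {u : functional | u \in sobolev_loc s p}.
HB.instance Definition _ s p := Choice.on (loc_space s p).

(* The open balls of the seminorms, which form a subbase of the topology *)
Definition loc_subbase s p : set (set (loc_space s p)) :=
  [set B | exists phi (u : loc_space s p) (e : R),
     0 < e /\ B = [set v | loc_seminorm s p phi (\val v - \val u) < e]].
HB.instance Definition _ s p :=
  isSubBaseTopological.Build (loc_space s p) (@loc_subbase s p) id.

(* Indices start at 0 instead of 1, whence the weight 2^-(j+1) *)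
Definition loc_dist s p (phi : nat -> testfun Omega) u v : R :=
  limn (series (fun j => 2^-1 ^+ j.+1 *
    (loc_seminorm s p (phi j) (u - v) /
     (1 + loc_seminorm s p (phi j) (u - v))))).

Definition loc_metric s p (phi : nat -> testfun Omega) (u v : loc_space s p) :=
  loc_dist s p phi (\val u) (\val v).

End sobolev.

Arguments loc_metric {R n Omega} s p phi.
Arguments sobolev0 {R n} Omega t p.
Arguments sobolev {R n} Omega s p.
Arguments sobolev_on {R n Omega} K s p.
Arguments sobolev_loc {R n} Omega s p.

Definition is_metric {R : realType} {T : Type} (d : T -> T -> R) :=
  [/\ forall x y, 0 <= d x y,
      forall x y, d x y = 0 <-> x = y,
      forall x y, d x y = d y x &
      forall x y z, d x z <= d x y + d y z].

Definition metric_compatible {R : realType} {T : topologicalType}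
    (d : T -> T -> R) :=
  forall A : set T, open A <->
    forall x, A x -> exists2 e : R, 0 < e & [set y | d x y < e] `<=` A.

Definition metrizable (R : realType) (T : topologicalType) :=
  exists d : T -> T -> R, is_metric d /\ metric_compatible d.

(* Main.v *)
Require Import Defs.
From mathcomp Require Import all_boot all_order all_algebra finmap.
From mathcomp Require Import all_classical all_reals all_analysis.
From mathcomp Require Import measurable_realfun.
From mathcomp Require Import ring lra.
Import Order.TTheory GRing.Theory Num.Theory.
Import numFieldNormedType.Exports.

Set Implicit Arguments.
Unset Strict Implicit.
Unset Printing Implicit Defensive.

Local Open Scope classical_set_scope.
Local Open Scope ring_scope.

(** A sequence of seminorms a_j that separates points and generates the topology
    of a vector space yields the translation invariant metric
    sum_j 2^-j a_j / (1 + a_j): the tail of the series is uniformly small, so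
    that small balls of the metric and finite intersections of small balls of
    the a_j are contained in each other.  What has to be shown is that the
    seminorms u |-> |phi_j u| of a countable admissible family separate points
    and control all the seminorms u |-> |psi u|.

    Control.  Given a test function psi, compactness of its support provides an
    N such that Phi = sum_(j < N) phi_j^2 has no zero on the support of psi.
    Hence psi = sum_(j < N) chi_j phi_j with the test functions
    chi_j = phi_j psi / Phi (admissible_decomposition).  Each phi_j u lives on
    the compact set supp phi_j, where multiplication by chi_j is bounded by
    hypothesis, and |psi u| <= sum_(j < N) C_j |phi_j u| follows from the
    triangle inequality (loc_seminorm_bounded).

    Separation.  The same decomposition shows that u = 0 as soon as every
    phi_j u is 0, so it remains to see that a distribution of norm zero is zero
    (sobolev_norm_eq0).  For s >= 0 this is the inequality of Hoelder.  For
    s < 0 the norm of u is that of a functional F on the closure of the test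
    functions in W^{-s,p'}; if this norm is small, then F, hence u, is small at
    every test function of norm at most 1.  The conclusion needs every test
    function to have finite norm in W^{t,q} for t = -s and q = p'.  Two facts
    give this.  By integration by parts, the distributional derivatives of a
    test function are represented by test functions (dist_pderiv_dist_of); the
    partial derivatives of a compactly supported function integrate to zero by
    Fubini and the fundamental theorem of calculus (integral_partial_eq0).  And
    the double integral of |phi x - phi y|^q / |x - y|^(n + theta q) converges,
    by comparison with geometric series on the dyadic shells of |x - y|
    (kernel_integral_fin).

    For s >= 0 the triangle inequality is Minkowski's, the Slobodeckij seminorm
    being the norm of a difference quotient in L^p of the product space
    (slobodeckijE).  Finally, a countable admissible family always exists: take
    products of functions exp(-1/t), one for each rational box in Omega
    (admissible_bump_family). *)

(** * A bounded combination of countably many seminorms *)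

Section frechet.
Context {R : realType}.
Implicit Types a b c : R^nat.

Definition frechet_term a j : R := 2^-1 ^+ j.+1 * (a j / (1 + a j)).

(** The sum metrizing countably many seminorms, at the sequence of their values.
    Indices start at 0, whence the weight 2^-(j+1). *)
Definition frechet a : R := limn (series (frechet_term a)).

Lemma bounded_ratio_mono (x y : R) : 0 <= x -> x <= y ->
  x / (1 + x) <= y / (1 + y).
Proof.
move=> x0 xy; have y0 := le_trans x0 xy.
rewrite ler_pdivrMr ?ltr_pwDl// mulrAC ler_pdivlMr ?ltr_pwDl//.
by rewrite !mulrDr !mulr1 (mulrC y x) lerD2r.
Qed.

(** Removing one summand from a denominator enlarges the fraction. *)
Lemma bounded_ratio_subadd (x y : R) : 0 <= x -> 0 <= y ->
  (x + y) / (1 + (x + y)) <= x / (1 + x) + y / (1 + y).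
Proof.
move=> x0 y0; rewrite mulrDl lerD// ler_wpM2l// lef_pV2 ?posrE ?ltr_pwDl//.
- by rewrite lerD2l lerDl.
- by rewrite addr_ge0.
- by rewrite lerD2l lerDr.
- by rewrite addr_ge0.
Qed.

Lemma frechet_term_ge0 a j : 0 <= a j -> 0 <= frechet_term a j.
Proof. by move=> a0; rewrite mulr_ge0 ?exprn_ge0 ?invr_ge0 ?divr_ge0 ?addr_ge0. Qed.

Lemma frechet_term_le a j : 0 <= a j -> frechet_term a j <= 2^-1 ^+ j.+1.
Proof.
move=> a0; rewrite ler_piMr ?exprn_ge0 ?invr_ge0//.
by rewrite ler_pdivrMr ?ltr_pwDl// mul1r lerDr.
Qed.

Lemma cvg_halves : series (fun j => 2^-1 ^+ j.+1 : R) @ \oo --> (1 : R).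
Proof.
have := @cvg_geometric_series_half R 1 0; rewrite expr0 divr1.
rewrite (_ : series _ = series (fun j => 2^-1 ^+ j.+1 : R))//.
apply/funext => k; apply: eq_bigr => i _ /=.
by rewrite addn1 div1r natrX exprVn.
Qed.

Lemma is_cvg_frechet a : (forall j, 0 <= a j) -> cvgn (series (frechet_term a)).
Proof.
move=> a0; apply: (@series_le_cvg _ _ (fun j => 2^-1 ^+ j.+1)).
- by move=> j; exact: frechet_term_ge0.
- by move=> j; rewrite exprn_ge0 ?invr_ge0.
- by move=> j; exact: frechet_term_le.
- exact: (cvgP _ cvg_halves).
Qed.

Lemma frechet_term_le_frechet a j : (forall j, 0 <= a j) ->
  frechet_term a j <= frechet a.
Proof.
move=> a0; apply: (@le_trans _ _ (series (frechet_term a) j.+1)).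
  rewrite /series/= big_nat_recr//= lerDr sumr_ge0// => i _.
  exact: frechet_term_ge0.
apply: (nondecreasing_cvgn_le _ (is_cvg_frechet a0)).
apply/nondecreasing_seqP => k; rewrite [leRHS]seriesSr lerDl.
exact: frechet_term_ge0.
Qed.

Lemma frechet_ge0 a : (forall j, 0 <= a j) -> 0 <= frechet a.
Proof.
move=> a0; apply: le_trans (frechet_term_le_frechet 0%N a0).
exact: frechet_term_ge0.
Qed.

Lemma frechet_eq0 a : (forall j, 0 <= a j) ->
  frechet a = 0 <-> forall j, a j = 0.
Proof.
move=> a0; split=> [aE j|aE].
  have := frechet_term_le_frechet j a0; rewrite aE => le0.
  have /eqP : frechet_term a j = 0.
    by apply/eqP; rewrite eq_le le0 frechet_term_ge0.
  rewrite /frechet_term mulrA.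
  rewrite mulf_eq0 invr_eq0 (gt_eqF (ltr_pwDl _ (a0 j)))// orbF.
  by rewrite mulf_eq0 gt_eqF ?exprn_gt0 ?invr_gt0// => /eqP.
rewrite /frechet (_ : series _ = cst 0) ?lim_cst//.
apply/funext => k; rewrite /series/= big1// => j _.
by rewrite /frechet_term aE mul0r mulr0.
Qed.

Lemma frechet_subadd a b c : (forall j, 0 <= a j) -> (forall j, 0 <= b j) ->
  (forall j, 0 <= c j) -> (forall j, c j <= a j + b j) ->
  frechet c <= frechet a + frechet b.
Proof.
move=> a0 b0 c0 cab; rewrite /frechet -limD; [|exact: is_cvg_frechet..].
have -> : series (frechet_term a) + series (frechet_term b) =
          series (fun j => frechet_term a j + frechet_term b j).
  by apply/funext => k; rewrite /series/= big_split.
apply: lim_series_le; first exact: is_cvg_frechet.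
  rewrite (_ : series _ = series (frechet_term a) + series (frechet_term b)).
    by apply: is_cvgD; exact: is_cvg_frechet.
  by apply/funext => k; rewrite /series/= big_split.
move=> j; rewrite /frechet_term -mulrDr ler_wpM2l ?exprn_ge0 ?invr_ge0//.
apply: le_trans (bounded_ratio_subadd (a0 j) (b0 j)).
exact: bounded_ratio_mono.
Qed.

(** Makes small balls of the metric lie inside a given ball of one seminorm. *)
Lemma frechet_small_term a j (e : R) : (forall j, 0 <= a j) -> 0 < e ->
  frechet a < 2^-1 ^+ j.+1 * (e / (1 + e)) -> a j < e.
Proof.
move=> a0 e0 ae; rewrite ltNge; apply/negP => ea; move: ae.
rewrite ltNge => /negP; apply.
apply: le_trans (frechet_term_le_frechet j a0).
by rewrite ler_wpM2l ?exprn_ge0 ?invr_ge0// bounded_ratio_mono// ltW.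
Qed.

Lemma sum_halves N k : (N <= k)%N ->
  \sum_(N <= j < k) 2^-1 ^+ j.+1 = 2^-1 ^+ N - 2^-1 ^+ k :> R.
Proof.
elim: k => [|k IH]; first by rewrite leqn0 => /eqP ->; rewrite big_geq// subrr.
rewrite leq_eqVlt ltnS => /predU1P[->|Nk]; first by rewrite big_geq// subrr.
by rewrite big_nat_recr//= IH// exprS; lra.
Qed.

(** Makes a finite intersection of balls of seminorms lie inside a ball of the
    metric: the terms from N on contribute at most 2^-N, whatever their size. *)
Lemma frechet_le_head a N (e : R) : (forall j, 0 <= a j) -> 0 <= e ->
  (forall j, (j < N)%N -> a j <= e) -> frechet a <= e + 2^-1 ^+ N.
Proof.
move=> a0 e0 aN; apply: limr_le; first exact: is_cvg_frechet.
near=> k; have Nk : (N <= k)%N by near: k; exact: nbhs_infty_ge.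
rewrite /series/= (big_cat_nat (leq0n N) Nk)//= lerD//.
  apply: (@le_trans _ _ (\sum_(0 <= j < N) 2^-1 ^+ j.+1 * e)).
    rewrite big_nat [leRHS]big_nat; apply: ler_sum => j /andP[_ jN].
    rewrite ler_wpM2l ?exprn_ge0 ?invr_ge0// (le_trans _ (aN _ jN))//.
    by rewrite ler_piMr// invf_le1 ?ltr_pwDl// lerDl.
  rewrite -mulr_suml ler_piMl//.
  by rewrite sum_halves// expr0 gerBl exprn_ge0 ?invr_ge0.
apply: (@le_trans _ _ (\sum_(N <= j < k) 2^-1 ^+ j.+1)).
  by apply: ler_sum => j _; exact: frechet_term_le.
by rewrite sum_halves// lerBlDr lerDl exprn_ge0 ?invr_ge0.
Unshelve. all: by end_near.
Qed.

End frechet.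

(** * Rational boxes, measurability and volume in R^n *)

Section rational_boxes.
Context {R : realType} {n : nat}.

Definition cbox (c : 'rV[R]_n) (r : R) : set 'rV[R]_n :=
  [set x | forall i, `|x 0 i - c 0 i| <= r].

Definition obox (c : 'rV[R]_n) (r : R) : set 'rV[R]_n :=
  [set x | forall i, `|x 0 i - c 0 i| < r].

Definition box_code := ({ffun 'I_n -> rat} * nat)%type.

Definition code_center (q : box_code) : 'rV[R]_n := \row_i ratr (q.1 i).

Definition code_radius (q : box_code) : R := q.2.+1%:R^-1.

(** With radius r = 1/(m+1) and 2 r < e, a centre closer than r to x keeps the
    whole closed box within distance e of x.  This one lemma yields the countable
    covers behind measurability and behind the admissible family. *)
Lemma rational_box_nbhs (U : set 'rV[R]_n) x : open U -> U x ->
  exists q, obox (code_center q) (code_radius q) x /\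
            cbox (code_center q) (code_radius q) `<=` U.
Proof.
move=> oU Ux; have : nbhs x U by exact: open_nbhs_nbhs.
move=> /nbhs_ballP[e /= e0 eU].
pose m := Num.truncn (2 / e); pose r : R := m.+1%:R^-1.
have r0 : 0 < r by rewrite invr_gt0 ltr0n.
have re : 2 * r < e.
  rewrite ltr_pdivrMr ?ltr0n// mulrC -ltr_pdivrMr//.
  by apply: truncnS_gt.
have cx i : exists c : rat, `|x 0 i - ratr c| < r.
  have [c /andP[c1 c2]] := @rat_in_itvoo R (x 0 i - r) (x 0 i + r) ltac:(lra).
  exists c; rewrite ltr_norml; move: c1 c2; rewrite !bnd_simp => c1 c2.
  by apply/andP; split; lra.
pose c := [ffun i => projT1 (cid (cx i))].
have cP i : `|x 0 i - ratr (c i)| < r by rewrite /c ffunE; case: cid.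
exists (c, m); split=> [i|y yc]; first by rewrite mxE; exact: cP.
apply: eU; split=> // i j; rewrite (ord1 i) /ball/=.
rewrite (_ : _ - _ = (x 0 j - ratr (c j)) - (y 0 j - ratr (c j))); last by lra.
apply: le_lt_trans (ler_normB _ _) _.
apply: le_lt_trans re; rewrite mulr_natl mulr2n lerD ?(ltW (cP j))//.
by have := yc j; rewrite mxE.
Qed.

Lemma closed_cbox c r : closed (cbox c r).
Proof.
rewrite (_ : cbox c r = \bigcap_i [set x | `|x 0 i - c 0 i| <= r]); last first.
  by apply/seteqP; split=> x xc i => [_|]; exact: xc.
apply: closed_bigI => i _.
apply: (@closed_comp _ _ (fun x : 'rV[R]_n => `|x 0 i - c 0 i|) [set t | t <= r]);
  last exact: closed_le.
move=> x _; apply: (@continuous_comp _ _ _ (fun y : 'rV[R]_n => y 0 i - c 0 i) Num.norm);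
  last exact: norm_continuous.
by apply: continuousB; [exact: coord_continuous|exact: cst_continuous].
Qed.

Lemma compact_cbox c r : compact (cbox c r).
Proof.
apply: subclosed_compact (@rV_compact R n (fun i => `[c 0 i - r, c 0 i + r]%classic) _) _.
- exact: closed_cbox.
- by move=> i; exact: segment_compact.
- move=> x xc i; have := xc i; rewrite /= in_itv/= ler_norml => /andP[? ?].
  by apply/andP; split; lra.
Qed.

Lemma measurable_cbox c r : measurable (cbox c r).
Proof.
rewrite (_ : cbox c r = \bigcap_(i in [set` predT])
    (@rV_coord R n i @^-1` [set t | `|t - c 0 i| <= r])); last first.
  by apply/seteqP; split=> x xc i => [_|]; exact: xc.
apply: fin_bigcap_measurable; first exact: finite_finset.
move=> i _; rewrite -[X in measurable X]setTI.
apply: measurable_rV_coord => //.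
rewrite (_ : [set t | _] = `[c 0 i - r, c 0 i + r]%classic)//.
by apply/seteqP; split=> t/=; rewrite in_itv/= ler_norml => /andP[? ?];
  apply/andP; split; lra.
Qed.

Lemma measurable_obox c r : measurable (obox c r).
Proof.
rewrite (_ : obox c r = \bigcap_(i in [set` predT])
    (@rV_coord R n i @^-1` [set t | `|t - c 0 i| < r])); last first.
  by apply/seteqP; split=> x xc i => [_|]; exact: xc.
apply: fin_bigcap_measurable; first exact: finite_finset.
move=> i _; rewrite -[X in measurable X]setTI.
apply: measurable_rV_coord => //.
rewrite (_ : [set t | _] = `]c 0 i - r, c 0 i + r[%classic)//.
by apply/seteqP; split=> t/=; rewrite in_itv/= ltr_norml => /andP[? ?];
  apply/andP; split; lra.
Qed.

(** The sigma-algebra is generated by the coordinates, which only sees boxes;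
    an open set is a countable union of rational ones. *)
Lemma measurable_open_rV (U : set 'rV[R]_n) : open U -> measurable U.
Proof.
move=> oU.
rewrite (_ : U = \bigcup_(q in [set q | obox (code_center q) (code_radius q) `<=` U])
    obox (code_center q) (code_radius q)); last first.
  apply/seteqP; split=> [x Ux|x [q /= qU]]; last exact: qU.
  have [q [qx qU]] := rational_box_nbhs oU Ux.
  by exists q => //= y yq; apply: qU => i; exact/ltW/yq.
rewrite bigcup_mkcond; apply: countable_bigcupT_measurable => [|q]; first exact: countableP.
by case: ifPn => _; [exact: measurable_obox|exact: measurable0].
Qed.

Lemma measurable_continuous_rV (f : 'rV[R]_n -> R) :
  continuous f -> measurable_fun setT f.
Proof.
move=> cf; apply: (measurability _ (RGenOInfty.measurableE R)) => //.
move=> _ [_ [a ->] <-]; rewrite setTI; apply: measurable_open_rV.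
apply: open_comp => [x _|]; first exact: cf.
exact: interval_open.
Qed.

End rational_boxes.

Arguments box_code n : clear implicits.

Lemma rV_lebesgue_cbox {R : realType} n (c : 'rV[R]_n) (r : R) : 0 <= r ->
  rV_lebesgue n (cbox c r) = ((2 * r) ^+ n)%:E.
Proof.
move=> r0; elim: n c => [|n IH] c.
  by rewrite /= diracE mem_set ?expr0// => -[].
rewrite /= /rV_measureS /pushforward/=.
rewrite (_ : _ @^-1` _ = `[c 0 ord0 - r, c 0 ord0 + r]%classic `*`
    cbox (\row_j c 0 (lift ord0 j)) r); last first.
  apply/seteqP; split=> -[a x]/=.
    move=> xc; split.
      have := xc ord0; rewrite mxE unlift_none/= in_itv/= ler_norml => /andP[? ?].
      by apply/andP; split; lra.
    by move=> i; have := xc (lift ord0 i); rewrite !mxE liftK.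
  move=> [ac xc] i; rewrite mxE; case: (unliftP ord0 i) => [j|] -> /=.
    by have := xc j; rewrite mxE.
  by move: ac; rewrite in_itv/= ler_norml => /andP[? ?]; apply/andP; split; lra.
rewrite product_measure1E//; last exact: measurable_cbox.
rewrite IH -[X in (X * _)%E]/(lebesgue_measure _) lebesgue_measure_itv/=.
have [r1|] := ltP 0 r; last first.
  move=> r1; have -> : r = 0 by apply/eqP; rewrite eq_le r1 r0.
  by rewrite subr0 addr0 ltxx mul0e mulr0 expr0n.
rewrite lte_fin ifT; last by lra.
by rewrite -EFinD -EFinM exprS; congr EFin; ring.
Qed.

(** * Bump functions and a countable admissible family *)

Section line_derivative.
Context {R : realType} {V : normedModType R}.
Implicit Types (f : V -> R) (x v : V).

(** Transfers one-variable calculus to partial derivatives and back. *)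
Lemma is_derive_line f x v (t df : R) :
  is_derive t 1 (fun t : R => f (t *: v + x)) df <->
  is_derive (t *: v + x) v f df.
Proof.
have E : (fun h : R => h^-1 *:
      (((fun t : R => f (t *: v + x)) \o shift t) (h *: 1) - f (t *: v + x))) =
    (fun h : R => h^-1 *:
      ((f \o shift (t *: v + x)) (h *: v) - f (t *: v + x))).
  by apply/funext => h /=; rewrite [h *: 1]mulr1 scalerDl addrA.
split=> -[d1 d2]; split.
- by rewrite /derivable -E.
- by rewrite /derive -E.
- by rewrite /derivable E.
- by rewrite /derive E.
Qed.

End line_derivative.

Section flat_exponential.
Context {R : realType}.
Implicit Types (m : nat) (t : R).

(** The function t^-m exp(-1/t) on t > 0, extended by 0.  The derivative of such a
    function is a linear combination of two others, so that smoothness is an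
    induction over all m at once. *)
Definition flat_exp m t : R := if 0 < t then t^-1 ^+ m * expR (- t^-1) else 0.

Lemma flat_exp_ge0 m t : 0 <= flat_exp m t.
Proof.
rewrite /flat_exp; case: ifPn => // t0.
by rewrite mulr_ge0 ?exprn_ge0 ?expR_ge0// invr_ge0 ltW.
Qed.

Lemma flat_exp_gt0 t : (0 < flat_exp 0 t) = (0 < t).
Proof.
by rewrite /flat_exp; case: ifPn => [t0|]; rewrite ?ltxx// expr0 mul1r expR_gt0.
Qed.

(** Since exp u >= (u / k)^k for u = 1/t and k = m + 2; the order 2 at the origin
    gives both continuity and a vanishing derivative there. *)
Lemma flat_exp_le m t : flat_exp m t <= m.+2%:R ^+ m.+2 * t ^+ 2.
Proof.
rewrite /flat_exp; case: ifPn => [t0|_]; last first.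
  by rewrite mulr_ge0 ?sqr_ge0 ?exprn_ge0.
have u0 : 0 < t^-1 by rewrite invr_gt0.
have ku : (t^-1 / m.+2%:R) ^+ m.+2 <= expR t^-1.
  set v := _ / _.
  have -> : expR t^-1 = expR v ^+ m.+2.
    by rewrite -expRM_natl /v mulrCA divff ?mulr1// pnatr_eq0.
  have v0 : 0 <= v by rewrite /v divr_ge0 ?ltW.
  rewrite lerXn2r ?nnegrE ?expR_ge0//.
  by apply: le_trans (expR_ge1Dx _); rewrite lerDr.
rewrite expRN ler_pdivrMr ?expR_gt0//.
apply: le_trans (ler_wpM2l _ ku); last by rewrite mulr_ge0 ?sqr_ge0 ?exprn_ge0.
rewrite [leRHS](_ : _ = t^-1 ^+ m)//.
rewrite exprMn -[in X in _ * (X * _)]addn2 exprD exprVn [t^-1 ^+ 2]exprVn.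
have : m.+2%:R ^+ m.+2 != 0 :> R by rewrite expf_eq0 pnatr_eq0.
have : t ^+ 2 != 0 by rewrite expf_eq0 gt_eqF.
rewrite exprVn; move: (t ^+ 2) (_ ^+ m.+2) (_ ^- m) => x y z x0 y0.
by field; apply/andP.
Qed.

Lemma is_derive_flat_exp m t :
  is_derive t 1 (flat_exp m) (flat_exp m.+2 t - m%:R * flat_exp m.+1 t).
Proof.
have [t0|t0|->] := ltrgtP t 0.
- rewrite /flat_exp ltNge (ltW t0)/= mulr0 subr0.
  apply: (@near_eq_is_derive _ _ _ (cst 0)).
  by near=> x; rewrite ltNge ltW//; near: x; exact: lt_nbhsl.
- rewrite {2 3}/flat_exp t0.
  apply: (@near_eq_is_derive _ _ _ ((fun u : R => u ^+ m * expR (- u)) \o GRing.inv)).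
    by near=> x; rewrite /flat_exp ifT//; near: x; exact: lt_nbhsr.
  have dV : is_derive t 1 (GRing.inv : R -> R) (- t ^- 2 *: 1).
    by apply: is_deriveV; rewrite gt_eqF.
  have dE : is_derive t^-1 1 (expR \o -%R) (expR (- t^-1) * - 1).
    by apply: is_derive1_comp; exact: is_deriveN.
  have dX : is_derive t^-1 1 (fun u : R => u ^+ m * expR (- u))
     (t^-1 ^+ m *: (expR (- t^-1) * - 1) +
      expR (- t^-1) *: (m%:R * t^-1 ^+ m.-1 *: 1)).
    rewrite (_ : (fun u : R => _) = id ^+ m * (expR \o -%R)); last first.
      by apply/funext => u; rewrite mulrfctE exprfctE.
    by have := is_deriveM (is_deriveX m (is_derive_id t^-1 1)) dE; rewrite exprfctE.
  apply: (is_derive_eq (is_derive1_comp dX dV)).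
  rewrite /GRing.scale/= !mulr1 -exprVn.
  by case: m {dX} => [|k]; rewrite ?mul0r ?exprS/=; ring.
- have f0 k : flat_exp k 0 = 0 :> R by rewrite /flat_exp ltxx.
  rewrite !f0 mulr0 subr0.
  have L : (fun h : R => h^-1 *: ((flat_exp m \o shift 0) (h *: 1) - flat_exp m 0))
             @ 0^' --> (0 : R).
    have C0 : 0 < m.+2%:R ^+ m.+2 :> R by rewrite exprn_gt0.
    apply/cvgr0Pnorm_le => e e0; near=> h.
    have h0 : h != 0 by near: h; exact: nbhs_dnbhs_neq.
    rewrite /= f0 subr0 addr0 [h *: 1]mulr1 normrM normfV (ger0_norm (flat_exp_ge0 _ _)).
    rewrite ler_pdivrMl ?normr_gt0//; apply: le_trans (flat_exp_le _ _) _.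
    rewrite -(real_normK (num_real h)) expr2 mulrCA ler_wpM2l//.
    rewrite -ler_pdivlMl// mulrC ltW//; near: h; apply: dnbhs0_lt.
    by rewrite divr_gt0.
  by split; [apply/cvg_ex; exists 0; exact: L|exact: cvg_lim L].
Unshelve. all: by end_near.
Qed.

Lemma continuous_flat_exp m : continuous (flat_exp m).
Proof.
move=> t; apply: differentiable_continuous; apply/derivable1_diffP.
by have [] := is_derive_flat_exp m t.
Qed.

End flat_exponential.

Section bump.
Context {R : realType} {n : nat}.

Lemma Ck_cst k (a : R) : Ck k (cst a : 'rV[R]_n -> R).
Proof.
have ca b : continuous (cst b : 'rV[R]_n -> R) by move=> x; exact: cst_continuous.
case: k => [|k]; split=> // i; split=> [x|]; first exact: derivable_cst.
rewrite (_ : partial i _ = 0); first exact: Ck0.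
by apply/funext => x; exact: derive_cst.
Qed.

Lemma Ck_prod k (I : Type) (s : seq I) (F : I -> 'rV[R]_n -> R) :
  (forall i, Ck k (F i)) -> Ck k (\prod_(i <- s) F i).
Proof.
by move=> CF; elim/big_ind: _ => // [|f g]; [exact: Ck_cst|exact: CkM].
Qed.

Lemma is_derive_affine_coord (h : R -> R) (dh a b : R) (i j : 'I_n) (x : 'rV[R]_n) :
  is_derive (a * x 0 i + b) 1 h dh ->
  is_derive x (delta_mx 0 j : 'rV[R]_n) (fun y => h (a * y 0 i + b))
    (a * (i == j)%:R * dh).
Proof.
move=> hd; rewrite -[x]add0r -(scale0r (delta_mx 0 j)).
apply/is_derive_line.
pose l (t : R) := (a * (i == j)%:R) * t + (a * x 0 i + b).
rewrite (_ : (fun t : R => _) = h \o l); last first.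
  apply/funext => t /=; rewrite /l !mxE eqxx/=; congr h.
  by rewrite mulrDr addrA (mulrC t) mulrA.
have dl : is_derive (0 : R) 1 l (a * (i == j)%:R).
  have := is_deriveD (is_deriveZ (a * (i == j)%:R) (is_derive_id (0 : R) 1))
    (is_derive_cst (a * x 0 i + b) (0 : R) 1).
  by rewrite addr0 [_ *: 1]mulr1.
by rewrite mulrC; apply: is_derive1_comp => //; rewrite /l mulr0 add0r.
Qed.

Lemma Ck_flat_exp_coord k m (a b : R) (i : 'I_n) :
  Ck k (fun x : 'rV[R]_n => flat_exp m (a * x 0 i + b)).
Proof.
have cf m' : continuous (fun x : 'rV[R]_n => flat_exp m' (a * x 0 i + b)).
  move=> x; apply: (@continuous_comp _ _ _ (fun x : 'rV[R]_n => a * x 0 i + b));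
    last exact: continuous_flat_exp.
  apply: continuousD; last exact: cst_continuous.
  by apply: continuousM; [exact: cst_continuous|exact: coord_continuous].
elim: k m => [|k IH] m; split=> // j.
have df (x : 'rV[R]_n) := is_derive_affine_coord j (is_derive_flat_exp m (a * x 0 i + b)).
split=> [x|]; first by have [] := df x.
rewrite (_ : partial j _ =
  (a * (i == j)%:R) *: (fun x : 'rV[R]_n => flat_exp m.+2 (a * x 0 i + b)) +
  ((- (a * (i == j)%:R * m%:R)) *:
    (fun x : 'rV[R]_n => flat_exp m.+1 (a * x 0 i + b)) + 0)).
  by apply: CkD => //; apply: CkD => //; exact: Ck0.
apply/funext => x; rewrite /partial; have [_ ->] := df x.
by rewrite addr0 mulrBr mulrA -mulNr.
Qed.

(** A product over the coordinates, so that it vanishes exactly off a box. *)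
Definition bump (c : 'rV[R]_n) (r : R) : 'rV[R]_n -> R :=
  \prod_i ((fun x : 'rV[R]_n => flat_exp 0 (1 * x 0 i + (r - c 0 i))) *
           (fun x : 'rV[R]_n => flat_exp 0 (-1 * x 0 i + (r + c 0 i)))).

Lemma bumpE c r x : bump c r x = \prod_i
  (flat_exp 0 (1 * x 0 i + (r - c 0 i)) * flat_exp 0 (-1 * x 0 i + (r + c 0 i))).
Proof.
rewrite /bump; elim/big_rec2: _ => // i f y _ <-.
by rewrite mulrfctE.
Qed.

Lemma smooth_bump c r : smooth (bump c r).
Proof. by move=> k; apply: Ck_prod => i; apply: CkM; exact: Ck_flat_exp_coord.
Qed.

Lemma bump_ge0 c r x : 0 <= bump c r x.
Proof. by rewrite bumpE prodr_ge0// => i _; rewrite mulr_ge0 ?flat_exp_ge0. Qed.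

Lemma bump_neq0 c r x : bump c r x != 0 <-> obox c r x.
Proof.
have E i : (flat_exp 0 (1 * x 0 i + (r - c 0 i)) *
    flat_exp 0 (-1 * x 0 i + (r + c 0 i)) != 0) = (`|x 0 i - c 0 i| < r).
  have nz t : (flat_exp 0 t != 0) = (0 < t).
    by rewrite -flat_exp_gt0 lt0r flat_exp_ge0 andbT.
  rewrite mulf_eq0 negb_or !nz ltr_norml.
  by apply/andP/andP => -[? ?]; split; lra.
rewrite bumpE; split=> [/prodf_neq0 xc i|xc]; first by rewrite -E; exact: xc.
by apply/prodf_neq0 => i _; rewrite E; exact: xc.
Qed.

Lemma supp_bump c r : supp (bump c r) `<=` cbox c r.
Proof.
apply: supp_subset; first exact: closed_cbox.
move=> x nx; apply: contrapT => /eqP/bump_neq0 xc; apply: nx => i.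
exact/ltW/xc.
Qed.

Lemma bump_testfun (Omega : set 'rV[R]_n) c r : cbox c r `<=` Omega ->
  bump c r \in testfun_pred Omega.
Proof.
move=> cO; apply/asboolP; split; first exact: smooth_bump.
- by apply: subclosed_compact (@compact_cbox R n c r) (@supp_bump c r); exact: closed_closure.
- exact: subset_trans (@supp_bump c r) cO.
Qed.

Definition bump_family (Omega : set 'rV[R]_n) (j : nat) : testfun Omega :=
  if choice.unpickle j is Some q then
    if pselect (cbox (code_center q) (code_radius q) `<=` Omega) is left qO
    then Testfun (bump_testfun qO) else 0
  else 0.

Lemma admissible_bump_family (Omega : set 'rV[R]_n) : open Omega ->
  admissible_family (range (@bump_family Omega)).
Proof.
move=> oO x Ox; have [q [qx qO]] := rational_box_nbhs oO Ox.
exists (bump_family Omega (choice.pickle q)); rewrite /bump_family choice.pickleK.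
case: pselect => // qO'; split=> [|y|]; first by exists (choice.pickle q) => //;
  rewrite /bump_family choice.pickleK; case: pselect => // ?; exact: val_inj.
- exact: bump_ge0.
- exact/bump_neq0.
Qed.

End bump.

(** * Dividing by the sum of squares of an admissible family *)

Section quotient.
Context {R : realType} {n : nat}.
Implicit Types f g : 'rV[R]_n -> R.

Lemma near_supp0 f x : ~ supp f x -> \forall y \near x, f y = 0.
Proof.
move=> nx; have : nbhs x (~` supp f).
  by apply: open_nbhs_nbhs; split => //; exact/closed_openC/closed_closure.
by apply: filterS => y; exact: supp0.
Qed.

(** Off supp f the quotient vanishes locally, so zeros of g there are harmless.
    The derivative is f' / g - ((f g') / g) / g, where every numerator is supported
    in supp f: the induction hypothesis applies to all three quotients. *)
Lemma Ck_div k f g : Ck k f -> Ck k g -> (forall x, supp f x -> g x != 0) ->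
  Ck k (fun x => f x * (g x)^-1).
Proof.
have cdiv f' g' : continuous f' -> continuous g' ->
    (forall x, supp f' x -> g' x != 0) -> continuous (fun x => f' x * (g' x)^-1).
  move=> cf cg fg.
  suff H (x : 'rV[R]_n) : continuous_at x (fun x => f' x * (g' x)^-1).
    by move=> x; exact: H.
  have [sx|nsx] := pselect (supp f' x).
    apply: (@continuousM _ _ f' (fun x => (g' x)^-1)); first exact: cf.
    by apply: continuousV; [exact: fg|exact: cg].
  rewrite /continuous_at (supp0 nsx) mul0r; apply: (@cvg_near_cst _ _ _ _ (nbhs x) _).
  by apply: filterS (near_supp0 nsx) => y ->; rewrite mul0r.
elim: k f g => [|k IH] f g Cf Cg fg.
  by split=> //; apply: cdiv => //; [exact: Ck_continuous Cf|exact: Ck_continuous Cg].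
split; first by apply: cdiv => //; [exact: Ck_continuous Cf|exact: Ck_continuous Cg].
move=> i; have [_ /(_ i)[df fk]] := Cf; have [_ /(_ i)[dg gk]] := Cg; split.
  move=> x; have [sx|nsx] := pselect (supp f x).
    by apply: derivableM => //; apply: derivableV => //; exact: fg.
  apply: (@near_eq_derivable _ _ _ (cst 0)); last exact: derivable_cst.
  by apply: filterS (near_supp0 nsx) => y ->; rewrite mul0r.
rewrite (_ : partial i _ =
    (-1) *: (fun x => (fun y => (f * partial i g) y * (g y)^-1) x * (g x)^-1)
    + (fun x => partial i f x * (g x)^-1)); last first.
  apply/funext => x; have [sx|nsx] := pselect (supp f x).
    rewrite /partial deriveM//; last by apply: derivableV => //; exact: fg.
    rewrite deriveV ?fg//=.
    by rewrite !fctE /GRing.scale/= -exprVn; ring.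
  have E : partial i (fun x : 'rV[R]_n => f x / g x) x = 0.
    rewrite /partial (@near_eq_derive _ _ _ _ (cst 0)) ?derive_cst//.
    by apply: filterS (near_supp0 nsx) => y ->; rewrite mul0r.
  rewrite {}E !fctE supp0 ?mul0r ?(@supp0 _ _ (partial i f)) ?mul0r ?scaler0 ?addr0//.
  by move=> /supp_partial.
have sM h : supp (f * h) `<=` supp f.
  apply: supp_subset => [|x nx]; first exact: closed_closure.
  by rewrite mulrfctE (supp0 nx) mul0r.
have sD h : supp (fun y => (f * h) y * (g y)^-1) `<=` supp f.
  apply: supp_subset => [|x nx]; first exact: closed_closure.
  by rewrite mulrfctE (supp0 nx) !mul0r.
apply: CkD.
  apply: (IH); [|exact: CkS|by move=> x /sD; exact: fg].
  apply: (IH); [|exact: CkS|by move=> x /sM; exact: fg].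
  by apply: CkM => //; exact: CkS.
by apply: IH => //; [exact: CkS|move=> x /supp_partial; exact: fg].
Qed.

End quotient.

Section partition.
Context {R : realType} {n : nat} {Omega : set 'rV[R]_n}.
Implicit Types (psi : testfun Omega) (phi : nat -> testfun Omega).

(** Squares, because a member of an admissible family may change sign. *)
Definition sum_squares phi N : 'rV[R]_n -> R :=
  \sum_(j < N) ((phi j : 'rV[R]_n -> R) * phi j).

Lemma sum_squaresE phi N x : sum_squares phi N x = \sum_(j < N) phi j x ^+ 2.
Proof.
rewrite /sum_squares; elim/big_rec2: _ => // i f y _ <-.
by rewrite addrfctE mulrfctE -expr2.
Qed.

Lemma smooth_sum_squares phi N : smooth (sum_squares phi N).
Proof.
move=> k; rewrite /sum_squares; elim/big_ind: _ => [|f g Cf Cg|j _].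
- exact: Ck0.
- by rewrite -(scale1r f); exact: CkD.
- by have [s _ _] := testfunP (phi j); apply: CkM; exact: s.
Qed.

(** Admissibility gives each point of the support a neighbourhood on which some
    phi_j, hence every later sum, has no zero; compactness makes N uniform. *)
Lemma sum_squares_neq0_near phi psi : admissible_family (range phi) ->
  \forall N \near \oo, supp psi `<=` [set x | sum_squares phi N x != 0].
Proof.
move=> adm; have [_ cpsi psiO] := testfunP psi.
move/compact_near_coveringP : cpsi.
move=> /(_ nat \oo (fun N x => sum_squares phi N x != 0) _); apply => x /psiO Ox.
have [_ [[j _ <-] _ phix]] := adm x Ox.
have [s _ _] := testfunP (phi j); have cj : continuous (phi j) := Ck_continuous (s 0%N).
exists ([set y | phi j y != 0], [set N | (j < N)%N]).
  split => /=; last exact: nbhs_infty_gt.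
  apply: (cvgr_neq0 _ (cj x)) => //.
move=> [y N] /= [yj jN]; rewrite sum_squaresE gt_eqF// (bigD1 (Ordinal jN))//=.
by rewrite ltr_pwDl ?exprn_even_gt0 ?sumr_ge0// => i _; exact: sqr_ge0.
Qed.

Lemma testfun_div_subproof phi psi N j :
  supp psi `<=` [set x | sum_squares phi N x != 0] ->
  (fun x => ((phi j : 'rV[R]_n -> R) * psi) x * (sum_squares phi N x)^-1)
    \in testfun_pred Omega.
Proof.
move=> nz; have [sphi _ _] := testfunP (phi j); have [spsi _ _] := testfunP psi.
have sM : supp ((phi j : 'rV[R]_n -> R) * psi) `<=` supp psi.
  apply: supp_subset => [|x nx]; first exact: closed_closure.
  by rewrite mulrfctE (supp0 nx) mulr0.
apply/asboolP/(@is_testfun_sub _ _ _ _ psi).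
- move=> k; apply: Ck_div; first exact: CkM.
    exact: smooth_sum_squares.
  by move=> x /sM; exact: nz.
- exact: testfunP.
- apply: supp_subset => [|x nx]; first exact: closed_closure.
  by rewrite mulrfctE (supp0 nx) mulr0 mul0r.
Qed.

Lemma testfun_sumE N (chi : nat -> testfun Omega) x :
  (\sum_(j < N) chi j : testfun Omega) x = \sum_(j < N) chi j x.
Proof. by elim/big_rec2: _ => // i f y _ <-. Qed.

(** Take chi_j = phi_j psi / Phi, where Phi is a sum of squares without zeros on the
    support of psi. *)
Lemma admissible_decomposition phi psi : admissible_family (range phi) ->
  exists N (chi : nat -> testfun Omega),
    psi = \sum_(j < N) testfun_mul (chi j) (phi j).
Proof.
move=> /sum_squares_neq0_near-/(_ psi)[N _ /(_ N (leqnn N)) nz].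
pose chi j := Testfun (testfun_div_subproof j nz); exists N, chi.
apply/val_inj/funext => x.
transitivity (\sum_(j < N) testfun_mul (chi j) (phi j) x); last first.
  exact/esym/(testfun_sumE N (fun j => testfun_mul (chi j) (phi j))).
have E j : testfun_mul (chi j) (phi j) x =
    phi j x ^+ 2 * (psi x / sum_squares phi N x).
  by rewrite /= !mulrfctE; ring.
under eq_bigr => j _ do rewrite E.
rewrite -mulr_suml -sum_squaresE mulrCA; have [sx|nsx] := pselect (supp psi x).
  by rewrite divff ?mulr1//; exact: (nz x sx).
by rewrite /= supp0// mul0r.
Qed.

End partition.

(** * The Sobolev norms are seminorms *)

Section infima.
Context {R : realType}.
Implicit Types A B C : set (\bar R).
Local Open Scope ereal_scope.

(** All the norms in play are infima over representatives or over extensions;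
    this turns subadditivity at the competitors into subadditivity of the norm. *)
Lemma ereal_inf_le_add A B C :
  (forall a, A a -> 0 <= a) -> (forall b, B b -> 0 <= b) ->
  (forall a b, A a -> B b -> exists2 c, C c & c <= a + b) ->
  ereal_inf C <= ereal_inf A + ereal_inf B.
Proof.
move=> A0 B0 CAB.
have iA : 0 <= ereal_inf A by apply: le_ereal_inf_tmp => a /A0.
have iB : 0 <= ereal_inf B by apply: le_ereal_inf_tmp => a /B0.
have [->|Aoo] := eqVneq (ereal_inf A) +oo.
  by rewrite addye ?leey// gt_eqF// (lt_le_trans _ iB).
have [->|Boo] := eqVneq (ereal_inf B) +oo.
  by rewrite addey ?leey// gt_eqF// (lt_le_trans _ iA).
have fA : ereal_inf A \is a fin_num by rewrite ge0_fin_numE// ltey.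
have fB : ereal_inf B \is a fin_num by rewrite ge0_fin_numE// ltey.
apply/lee_addgt0Pr => e e0; have e20 : (0 < e / 2)%R by rewrite divr_gt0.
have [a Aa ae] := lb_ereal_inf_adherent e20 fA.
have [b Bb be] := lb_ereal_inf_adherent e20 fB.
have [c Cc cab] := CAB _ _ Aa Bb.
apply: le_trans (ereal_inf_lbound Cc) _; apply: le_trans cab _.
rewrite [e]splitr EFinD addeACA; exact/ltW/lteD.
Qed.

Lemma ereal_inf_le_scale A C (k : R) : (0 < k)%R ->
  (forall a, A a -> exists2 c, C c & c <= k%:E * a) ->
  ereal_inf C <= k%:E * ereal_inf A.
Proof.
move=> k0 CA; rewrite -lee_pdivrMl//; apply: le_ereal_inf_tmp => a Aa.
have [c Cc ca] := CA a Aa.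
by rewrite lee_pdivrMl//; exact: le_trans (ereal_inf_lbound Cc) ca.
Qed.

End infima.

Section Lnorm_scale.
Context d (T : measurableType d) {R : realType} (mu : {measure set T -> \bar R}).
Local Open Scope ereal_scope.

Lemma Lnorm_scale (f : T -> R) (c p : R) : measurable_fun setT f -> (0 < p)%R ->
  Lnorm mu p%:E (EFin \o (fun x => c * f x)%R) = `|c|%:E * Lnorm mu p%:E (EFin \o f).
Proof.
move=> mf p0; rewrite unlock /Lnorm.
rewrite (eq_integral (fun x => (`|c|%R `^ p)%R%:E * (`|(f x)%:E| `^ p))); last first.
  by move=> x _ /=; rewrite -EFinM -powRM// -normrM.
rewrite ge0_integralZl//=.
- rewrite poweRM ?integral_ge0 ?lee_fin ?powR_ge0//; congr (_ * _).
  by rewrite poweR_EFin -powRrM mulfV ?gt_eqF// powRr1.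
- apply/measurable_EFinP/(@measurableT_comp _ _ _ _ _ _ (@powR R ^~ p)) => //.
  exact: measurableT_comp.
Qed.

End Lnorm_scale.

Section represents.
Context {R : realType} {n : nat} (Omega : set 'rV[R]_n).
Hypothesis oO : open Omega.
Implicit Types (f g : 'rV[R]_n -> R) (u v : testfun Omega -> R).

Let mO : measurable Omega := measurable_open_rV oO.

Lemma representsD f g u v : represents f u -> represents g v ->
  represents (f \+ g) (u + v).
Proof.
move=> [mf fu] [mg gv]; split; first exact: measurable_funD.
move=> phi; have [fi fE] := fu phi; have [gi gE] := gv phi.
have E : EFin \o ((f \+ g) \* phi) = ((EFin \o (f \* phi)%R) \+ (EFin \o (g \* phi)%R))%E.
  by apply/funext => x /=; rewrite mulrDl.
split; first by rewrite E; exact: integrableD.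
rewrite addrfctE fE gE -RintegralD//; apply: eq_Rintegral => x _ /=.
by rewrite mulrDl.
Qed.

Lemma representsZ c f u : represents f u ->
  represents (fun x => c * f x) (c *: u).
Proof.
move=> [mf fu]; split; first by apply: measurable_funM => //; exact: measurable_cst.
move=> phi; have [fi fE] := fu phi.
have E : EFin \o ((fun x => c * f x) \* phi) = (fun x => c%:E * (EFin \o (f \* phi)%R) x)%E.
  by apply/funext => x /=; rewrite -mulrA.
split; first by rewrite E; exact: integrableZl.
rewrite [LHS](_ : _ = c * u phi)// fE -RintegralZl//; apply: eq_Rintegral => x _ /=.
by rewrite mulrA.
Qed.

Lemma represents0 : represents (cst 0) (0 : testfun Omega -> R).
Proof.
split=> [|phi]; first exact: measurable_cst.
have E : (cst 0 : 'rV[R]_n -> R) \* phi = cst 0.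
  by apply/funext => x /=; rewrite mul0r.
split; first by rewrite E; exact: integrable0.
by rewrite /Rintegral (eq_integral (cst 0%E)) ?integral0// => x _; rewrite /= mul0r.
Qed.

Lemma measurable_representative f u : represents f u -> measurable_fun setT (f \_ Omega).
Proof. by move=> [mf _]; exact: (measurable_restrictT f mO).1. Qed.

End represents.

Section slobodeckij_quotient.
Context {R : realType} {n : nat} (Omega : set 'rV[R]_n).
Implicit Types (f g : 'rV[R]_n -> R) (theta p a : R).

(** With a = (n + theta p) / p, the p-th power of this quotient is the integrand of
    the Slobodeckij seminorm. *)
Definition slobodeckij_quot a f (z : 'rV[R]_n * 'rV[R]_n) : R :=
  (f z.1 - f z.2) * eucl_norm (z.1 - z.2) `^ (- a).

(** Gives access to the inequality of Minkowski for the Slobodeckij seminorm. *)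
Lemma slobodeckijE theta p f : 0 < p ->
  slobodeckij Omega theta p f =
  Lnorm (rV_lebesgue n \x rV_lebesgue n)%E p%:E
    (EFin \o (slobodeckij_quot ((n%:R + theta * p) / p) f \_ (Omega `*` Omega))).
Proof.
move=> p0; rewrite unlock /Lnorm /slobodeckij; congr (_ `^ _)%E.
rewrite [LHS]integral_mkcond; apply: eq_integral => z _.
rewrite /patch/=; case: ifPn => _; last by rewrite normr0 powR0// gt_eqF.
congr EFin; rewrite /slobodeckij_quot normrM powRM//; congr (_ * _).
rewrite ger0_norm ?powR_ge0// -powRrM mulNr powRN; congr (_ `^ _)^-1.
by rewrite divfK// gt_eqF.
Qed.

Lemma measurable_eucl_dist :
  measurable_fun setT (fun z : 'rV[R]_n * 'rV[R]_n => eucl_norm (z.1 - z.2)).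
Proof.
apply: (measurableT_comp (continuous_measurable_fun (@sqrt_continuous R))).
apply: measurable_sum => i; apply: measurable_funX.
rewrite (_ : (fun z => _) = (@rV_coord R n i \o fst) \- (@rV_coord R n i \o snd)).
  by apply: measurable_funB; apply: measurableT_comp (measurable_rV_coord i) _.
by apply/funext => z /=; rewrite !mxE.
Qed.

Lemma measurable_slobodeckij_quot a f : measurable Omega -> measurable_fun Omega f ->
  measurable_fun setT (slobodeckij_quot a f \_ (Omega `*` Omega)).
Proof.
move=> mO mf; apply: (measurable_restrictT _ (measurableX mO mO)).1.
apply: measurable_funM; last first.
  apply: (measurable_funS measurableT) => //.
  exact: measurableT_comp (measurable_powR _) measurable_eucl_dist.
apply: measurable_funB; apply: (measurable_comp mO _ mf).
- by move=> _ [z [z1 z2] <-].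
- by apply: measurable_funS measurable_fst => //.
- by move=> _ [z [z1 z2] <-].
- by apply: measurable_funS measurable_snd => //.
Qed.

End slobodeckij_quotient.

Section seminorms.
Context {R : realType} {n : nat} (Omega : set 'rV[R]_n).
Hypothesis oO : open Omega.
Implicit Types (u v : testfun Omega -> R) (theta p q s t c : R).
Local Open Scope ereal_scope.

Let mO : measurable Omega := measurable_open_rV oO.

Lemma slobodeckij_ge0 theta p f : 0 <= slobodeckij Omega theta p f.
Proof. exact: poweR_ge0. Qed.

Lemma dist_Lnorm_ge0 p u : 0 <= dist_Lnorm p u.
Proof. by apply: le_ereal_inf_tmp => _ [f _ <-]; exact: Lnorm_ge0. Qed.

Lemma dist_slobodeckij_ge0 theta p u : 0 <= dist_slobodeckij theta p u.
Proof. by apply: le_ereal_inf_tmp => _ [f _ <-]; exact: slobodeckij_ge0. Qed.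

Lemma dist_LnormD p u v : (1 <= p)%R ->
  dist_Lnorm p (u + v)%R <= dist_Lnorm p u + dist_Lnorm p v.
Proof.
move=> p1; apply: ereal_inf_le_add.
- by move=> _ [f _ <-]; exact: Lnorm_ge0.
- by move=> _ [f _ <-]; exact: Lnorm_ge0.
move=> _ _ [f fu <-] [g gv <-].
exists (Lnorm (rV_lebesgue n) p%:E (EFin \o ((f \+ g)%R \_ Omega))).
  by exists (f \+ g)%R => //; exact: representsD.
rewrite (_ : (f \+ g)%R \_ Omega = (f \_ Omega \+ g \_ Omega)%R).
  apply: minkowski_EFin => //; first exact: (measurable_representative oO fu).
  exact: (measurable_representative oO gv).
by apply/funext => x /=; rewrite /patch; case: ifPn => //; rewrite addr0.
Qed.

Lemma dist_LnormZ p c u : (0 < p)%R -> (c != 0)%R ->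
  dist_Lnorm p (c *: u)%R <= `|c|%:E * dist_Lnorm p u.
Proof.
move=> p0 c0; apply: ereal_inf_le_scale; first by rewrite normr_gt0.
move=> _ [f fu <-].
exists (Lnorm (rV_lebesgue n) p%:E (EFin \o ((fun x => c * f x)%R \_ Omega))).
  by exists (fun x => c * f x)%R => //; exact: representsZ.
rewrite -Lnorm_scale//; last exact: (measurable_representative oO fu).
rewrite (_ : (fun x => c * f x)%R \_ Omega = (fun x => c * (f \_ Omega) x)%R)//.
by apply/funext => x /=; rewrite /patch; case: ifPn => //; rewrite mulr0.
Qed.

Lemma dist_Lnorm0 p : (0 < p)%R -> dist_Lnorm p (0 : testfun Omega -> R)%R = 0.
Proof.
move=> p0; apply/eqP; rewrite eq_le dist_Lnorm_ge0 andbT.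
apply: ereal_inf_lbound; exists (cst 0%R) => /=; first exact: represents0.
rewrite (_ : EFin \o _ = cst 0) ?Lnorm0//; first by rewrite eqe gt_eqF.
by apply/funext => x /=; rewrite /patch; case: ifPn.
Qed.

Lemma dist_slobodeckijD theta p u v : (1 <= p)%R ->
  dist_slobodeckij theta p (u + v)%R <=
  dist_slobodeckij theta p u + dist_slobodeckij theta p v.
Proof.
move=> p1; have p0 : (0 < p)%R := lt_le_trans ltr01 p1.
apply: ereal_inf_le_add.
- by move=> _ [f _ <-]; exact: slobodeckij_ge0.
- by move=> _ [f _ <-]; exact: slobodeckij_ge0.
move=> _ _ [f fu <-] [g gv <-].
exists (slobodeckij Omega theta p (f \+ g)%R).
  by exists (f \+ g)%R => //; exact: representsD.
rewrite !slobodeckijE//; set a := (_ / p)%R.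
rewrite (_ : slobodeckij_quot a _ \_ _ =
  (slobodeckij_quot a f \_ (Omega `*` Omega) \+
   slobodeckij_quot a g \_ (Omega `*` Omega))%R).
  apply: minkowski_EFin => //; apply: measurable_slobodeckij_quot => //.
    by case: fu.
  by case: gv.
apply/funext => z /=; rewrite /patch; case: ifPn => //; rewrite ?addr0//.
by move=> _; rewrite /slobodeckij_quot -mulrDl/= opprD addrACA.
Qed.

Lemma dist_slobodeckijZ theta p c u : (0 < p)%R -> (c != 0)%R ->
  dist_slobodeckij theta p (c *: u)%R <= `|c|%:E * dist_slobodeckij theta p u.
Proof.
move=> p0 c0; apply: ereal_inf_le_scale; first by rewrite normr_gt0.
move=> _ [f fu <-].
exists (slobodeckij Omega theta p (fun x => c * f x)%R).
  by exists (fun x => c * f x)%R => //; exact: representsZ.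
rewrite !slobodeckijE// -Lnorm_scale//; last first.
  by apply: measurable_slobodeckij_quot => //; case: fu.
set a := (_ / p)%R.
rewrite (_ : slobodeckij_quot a _ \_ _ =
  (fun x => c * (slobodeckij_quot a f \_ (Omega `*` Omega)) x)%R)//.
apply/funext => z /=; rewrite /patch; case: ifPn => //; rewrite ?mulr0//.
by move=> _; rewrite /slobodeckij_quot mulrA mulrBr.
Qed.

Lemma dist_slobodeckij0 theta p : (0 < p)%R ->
  dist_slobodeckij theta p (0 : testfun Omega -> R)%R = 0.
Proof.
move=> p0; apply/eqP; rewrite eq_le dist_slobodeckij_ge0 andbT.
apply: ereal_inf_lbound; exists (cst 0%R) => /=; first exact: represents0.
rewrite slobodeckijE// (_ : EFin \o _ = cst 0) ?Lnorm0//.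
  by rewrite eqe gt_eqF.
apply/funext => x /=; rewrite /patch; case: ifPn => // _.
by rewrite /slobodeckij_quot subrr mul0r.
Qed.

Lemma dist_pderivD nu u v :
  dist_pderiv nu (u + v)%R = (dist_pderiv nu u + dist_pderiv nu v)%R.
Proof. by apply/funext => phi; rewrite /dist_pderiv !addrfctE mulrDr. Qed.

Lemma dist_pderivZ nu c u : dist_pderiv nu (c *: u)%R = (c *: dist_pderiv nu u)%R.
Proof.
apply/funext => phi; rewrite /dist_pderiv.
by rewrite [RHS](_ : _ = c * ((-1) ^+ morder nu * u (testfun_pderiv nu phi)))%R// mulrCA.
Qed.

Lemma dist_pderiv0 nu : dist_pderiv nu (0 : testfun Omega -> R)%R = 0%R.
Proof. by apply/funext => phi; rewrite /dist_pderiv mulr0. Qed.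

Lemma sobolev_pnorm_ge0 t p u : 0 <= sobolev_pnorm t p u.
Proof.
rewrite /sobolev_pnorm adde_ge0//.
  by apply: sume_ge0 => nu _; exact: dist_Lnorm_ge0.
by case: ifPn => // _; apply: sume_ge0 => nu _; exact: dist_slobodeckij_ge0.
Qed.

Lemma sobolev_pnormD t p u v : (1 <= p)%R ->
  sobolev_pnorm t p (u + v)%R <= sobolev_pnorm t p u + sobolev_pnorm t p v.
Proof.
move=> p1; rewrite /sobolev_pnorm addeACA leeD//.
  by rewrite -big_split/=; apply: lee_sum => nu _; rewrite dist_pderivD dist_LnormD.
case: ifPn => [_|_]; first by rewrite adde0.
by rewrite -big_split/=; apply: lee_sum => nu _; rewrite dist_pderivD dist_slobodeckijD.
Qed.

Lemma sobolev_pnormZ t p c u : (0 < p)%R -> (c != 0)%R ->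
  sobolev_pnorm t p (c *: u)%R <= `|c|%:E * sobolev_pnorm t p u.
Proof.
move=> p0 c0; rewrite /sobolev_pnorm ge0_muleDr; first last.
- by case: ifPn => // _; apply: sume_ge0 => nu _; exact: dist_slobodeckij_ge0.
- by apply: sume_ge0 => nu _; exact: dist_Lnorm_ge0.
apply: leeD.
  rewrite ge0_sume_distrr; last by move=> nu _; exact: dist_Lnorm_ge0.
  by apply: lee_sum => nu _; rewrite dist_pderivZ dist_LnormZ.
case: ifPn => [_|_]; first by rewrite mule0.
rewrite ge0_sume_distrr; last by move=> nu _; exact: dist_slobodeckij_ge0.
by apply: lee_sum => nu _; rewrite dist_pderivZ dist_slobodeckijZ.
Qed.

Lemma sobolev_pnorm0 t p : (0 < p)%R ->
  sobolev_pnorm t p (0 : testfun Omega -> R)%R = 0.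
Proof.
move=> p0; rewrite /sobolev_pnorm big1 ?add0e => [|nu _]; last first.
  by rewrite dist_pderiv0 dist_Lnorm0.
by case: ifPn => // _; rewrite big1// => nu _; rewrite dist_pderiv0 dist_slobodeckij0.
Qed.

Lemma is_distribution0 : is_distribution (0 : testfun Omega -> R)%R.
Proof.
split=> [a phi psi|K _ _]; first by rewrite [RHS](_ : _ = a * 0 + 0)%R// mulr0 addr0.
by exists 0%R, 0%N => phi _; rewrite normr0 mul0r.
Qed.

Lemma sobolev0_0 t q : (0 < q)%R -> sobolev0 Omega t q 0%R.
Proof.
move=> q0; split; [exact: is_distribution0|by rewrite sobolev_pnorm0|].
move=> e e0; exists 0%R; rewrite (_ : _ - _ = 0)%R ?sobolev_pnorm0 ?lte_fin//.
apply/funext => phi; rewrite /dist_of /Rintegral !fctE sub0r.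
by rewrite (eq_integral (cst 0)) ?integral0 ?oppr0// => x _; rewrite /= mul0r.
Qed.

Lemma dual_norm_ge0 t q (F : (testfun Omega -> R) -> R) : (0 < q)%R -> 0 <= dual_norm t q F.
Proof.
move=> q0; apply: (@le_trans _ _ `|F 0%R|%:E) => //.
apply: ereal_sup_ubound; exists 0%R => //; split; first exact: sobolev0_0.
by rewrite sobolev_pnorm0.
Qed.

Lemma conj_exponent_gt0 p : (1 < p)%R -> (1 < p / (p - 1))%R.
Proof. by move=> p1; rewrite ltr_pdivlMr ?subr_gt0// mul1r ltrBlDr ltrDl. Qed.

Lemma sobolev_norm_ge0 s p u : (1 < p)%R -> 0 <= sobolev_norm s p u.
Proof.
move=> p1; rewrite /sobolev_norm; case: ifPn => _; first exact: sobolev_pnorm_ge0.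
apply: le_ereal_inf_tmp => _ [F _ <-]; apply: dual_norm_ge0.
exact: lt_trans (conj_exponent_gt0 p1).
Qed.

(** For s < 0, the sum of extensions of u and of v extends u + v. *)
Lemma sobolev_normD s p u v : (1 < p)%R ->
  sobolev_norm s p (u + v)%R <= sobolev_norm s p u + sobolev_norm s p v.
Proof.
move=> p1; have q0 := lt_trans ltr01 (conj_exponent_gt0 p1).
rewrite /sobolev_norm; case: ifPn => _; first by rewrite sobolev_pnormD// ltW.
apply: ereal_inf_le_add.
- by move=> _ [F _ <-]; exact: dual_norm_ge0.
- by move=> _ [F _ <-]; exact: dual_norm_ge0.
move=> _ _ [F [lF Fu] <-] [G [lG Gv] <-].
exists (dual_norm (- s) (p / (p - 1)) (F \+ G)%R).
  exists (F \+ G)%R => //; split=> [a x y Vx Vy|phi] /=.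
    by rewrite lF// lG//; ring.
  by rewrite Fu Gv.
apply: ge_ereal_sup => _ [x Vx <-] /=.
apply: (@le_trans _ _ (`|F x| + `|G x|)%:E); first by rewrite lee_fin ler_normD.
by rewrite EFinD leeD//; apply: ereal_sup_ubound; exists x.
Qed.

Lemma sobolev_normN s p u : (1 < p)%R ->
  sobolev_norm s p (- u)%R <= sobolev_norm s p u.
Proof.
move=> p1; rewrite /sobolev_norm; case: ifPn => _.
  have := @sobolev_pnormZ s p (-1) u (lt_trans ltr01 p1).
  by rewrite scaleN1r normrN1 mul1e oppr_eq0 oner_eq0; exact.
apply: le_ereal_inf_tmp => _ [F [lF Fu] <-].
apply: ereal_inf_lbound; exists (fun x => - F x)%R.
  by split=> [a x y Vx Vy|phi]; rewrite ?Fu// lF//; ring.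
rewrite /dual_norm; congr ereal_sup.
by apply/seteqP; split=> _ [x Vx <-]; exists x; rewrite ?normrN.
Qed.

End seminorms.

(** * Test functions against p-integrable functions *)

Section compact_support.
Context {R : realType} {n : nat}.
Implicit Types (f g : 'rV[R]_n -> R) (M r q : R).

Lemma entry_le_norm (x : 'rV[R]_n) i : `|x 0 i| <= `|x|.
Proof.
have /mapP[j Hj ->] : `|x 0 i| \in [seq `|x ij.1 ij.2| | ij : 'I_1 * 'I_n].
  by apply/mapP; exists (ord0, i) => //=; rewrite mem_enum.
by rewrite [leRHS]/Num.norm /= mx_normrE; apply/bigmax_geP; right => /=; exists j.
Qed.

Lemma compact_sub_cbox (K : set 'rV[R]_n) : compact K ->
  exists2 r, 0 <= r & K `<=` cbox 0 r.
Proof.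
move=> /compact_bounded[M [_ KM]]; exists (`|M| + 1); first by rewrite addr_ge0.
move=> x Kx i; rewrite mxE subr0; apply: le_trans (entry_le_norm x i) _.
by apply: (KM (`|M| + 1)) => //; rewrite ltr_pwDr// ler_norm.
Qed.

Lemma continuous_compact_supp_bounded f : continuous f -> compact (supp f) ->
  exists M r, [/\ 0 <= M, 0 <= r, forall x, `|f x| <= M & supp f `<=` cbox 0 r].
Proof.
move=> cf cK; have [r r0 Kr] := compact_sub_cbox cK.
have : compact (f @` supp f).
  by apply: continuous_compact cK; exact: continuous_subspaceT.
move=> /compact_bounded[M [_ fM]]; exists (`|M| + 1), r.
split=> [|//|x|//]; first by rewrite addr_ge0.
have [sx|nsx] := pselect (supp f x); last by rewrite supp0// normr0 addr_ge0.
by apply: (fM (`|M| + 1)); [rewrite ltr_pwDr// ler_norm|exists x].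
Qed.

Lemma integral_powR_le f M r q : measurable_fun setT f -> 0 <= r -> 0 < q ->
  (forall x, `|f x| <= M) -> (forall x, ~ cbox 0 r x -> f x = 0) ->
  (\int[rV_lebesgue n]_x (`|f x| `^ q)%:E <= (M `^ q * (2 * r) ^+ n)%:E)%E.
Proof.
move=> mf r0 q0 fM fr.
apply: (@le_trans _ _ (\int[rV_lebesgue n]_x (M `^ q * \1_(cbox 0 r) x)%:E)%E).
  apply: ge0_le_integral => //.
  - apply/measurable_EFinP; apply: (measurableT_comp (measurable_powR q)).
    exact: measurableT_comp.
  - apply/measurable_EFinP; apply: measurable_funM; first exact: measurable_cst.
    by apply: measurable_indic; exact: measurable_cbox.
  move=> x _; rewrite lee_fin indicE.
  have [xr|nxr] := pselect (cbox 0 r x).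
    by rewrite mem_set// mulr1 ge0_ler_powR ?nnegrE ?(ltW q0)// (le_trans _ (fM x)).
  by rewrite memNset// mulr0 fr// normr0 powR0// gt_eqF.
rewrite (integralZl_indic measurableT (fun=> cbox 0 r)); first last.
- exact: measurable_cbox.
- by move=> /lt_geF; rewrite powR_ge0.
rewrite integral_indic ?setIT//; last exact: measurable_cbox.
by rewrite EFinM -(rV_lebesgue_cbox (0 : 'rV[R]_n) r0).
Qed.

End compact_support.

Section testfun_integrals.
Context {R : realType} {n : nat} (Omega : set 'rV[R]_n).
Hypothesis oO : open Omega.
Implicit Types (phi psi : testfun Omega) (u : testfun Omega -> R).

Let mO : measurable Omega := measurable_open_rV oO.

Lemma testfun_continuous phi : continuous phi.
Proof. by have [s _ _] := testfunP phi; exact: (Ck_continuous (s 0%N)). Qed.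

Lemma testfun_measurable phi : measurable_fun setT phi.
Proof. apply: measurable_continuous_rV; exact: testfun_continuous. Qed.

Lemma testfun_bounded phi :
  exists M r, [/\ 0 <= M, 0 <= r, forall x, `|phi x| <= M & supp phi `<=` cbox 0 r].
Proof.
have [_ c _] := testfunP phi.
exact: (continuous_compact_supp_bounded (@testfun_continuous phi)).
Qed.

Lemma testfun_out phi x : ~ Omega x -> phi x = 0.
Proof. by move=> nO; apply: supp0; have [_ _ sO] := testfunP phi => /sO. Qed.

Lemma testfun_Lnorm_fin q phi : 0 < q ->
  Lnorm (rV_lebesgue n) q%:E (EFin \o phi) \is a fin_num.
Proof.
move=> q0; have [M [r [M0 r0 phiM phir]]] := testfun_bounded phi.
rewrite ge0_fin_numE ?Lnorm_ge0// unlock /Lnorm poweR_lty//.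
apply: le_lt_trans (integral_powR_le (testfun_measurable phi) r0 q0 phiM _) (ltry _).
by move=> x nx; apply: supp0 => /phir.
Qed.

Lemma integrable_testfun phi :
  (rV_lebesgue n).-integrable setT (EFin \o phi).
Proof.
apply/integrableP; split.
  by apply/measurable_EFinP; exact: testfun_measurable.
have := testfun_Lnorm_fin phi ltr01; rewrite Lnorm1 ge0_fin_numE//.
exact: integral_ge0.
Qed.

Lemma integrable_testfun_on phi :
  (rV_lebesgue n).-integrable Omega (EFin \o phi).
Proof. by apply: integrableS (integrable_testfun phi). Qed.

(** The inequality of Hoelder, applied to a representative of u extended by 0. *)
Lemma represents_bound p q (f : 'rV[R]_n -> R) u phi :
  0 < p -> 0 < q -> p^-1 + q^-1 = 1 -> represents f u ->
  (`|u phi|%:E <= Lnorm (rV_lebesgue n) p%:E (EFin \o (f \_ Omega)) *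
                  Lnorm (rV_lebesgue n) q%:E (EFin \o phi))%E.
Proof.
move=> p0 q0 pq fu; have [mf /(_ phi)[fi ->]] := fu.
have mfO := measurable_representative oO fu.
apply: le_trans (hoelder _ mfO (testfun_measurable phi) p0 q0 pq).
rewrite Lnorm1 -abse_EFin /Rintegral fineK; last exact: integrable_fin_num.
apply: le_trans (le_abse_integral _ mO _) _; first by case/integrableP: fi.
rewrite [leLHS]integral_mkcond le_eqVlt; apply/orP; left; apply/eqP.
apply: eq_integral => x _ /=; rewrite /patch; case: ifPn => // _.
by rewrite mul0r normr0.
Qed.

(** The multi-index 0 contributes the L^p norm of u itself. *)
Lemma dist_Lnorm_le_pnorm t p u : (dist_Lnorm p u <= sobolev_pnorm t p u)%E.
Proof.
pose nu0 : mindex n (Num.truncn t) := [ffun=> ord0].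
have m0 : morder nu0 = 0%N by rewrite /morder big1// => i _; rewrite /mindex_fun ffunE.
have E : dist_pderiv nu0 u = u.
  apply/funext => phi; rewrite /dist_pderiv m0 expr0 mul1r; congr u.
  rewrite /testfun_pderiv; elim: (enum 'I_n) => //= i s ->.
  by rewrite /mindex_fun ffunE.
rewrite /sobolev_pnorm (bigD1 nu0) ?m0//= E -addeA leeDl//.
rewrite adde_ge0//; first by apply: sume_ge0 => nu _; exact: dist_Lnorm_ge0.
by case: ifPn => // _; apply: sume_ge0 => nu _; exact: dist_slobodeckij_ge0.
Qed.

(** By Hoelder, |u phi| is at most ||f||_p ||phi||_p' for every representative f,
    and ||f||_p may be taken arbitrarily small. *)
Lemma sobolev_pnorm_eq0 t p u : 1 < p -> sobolev_pnorm t p u = 0%E -> u = 0.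
Proof.
move=> p1 u0; apply/funext => phi.
have p0 := lt_trans ltr01 p1.
have q0 : 0 < p / (p - 1) by exact: lt_trans ltr01 (conj_exponent_gt0 p1).
have pq : p^-1 + (p / (p - 1))^-1 = 1.
  by rewrite invf_div mulrBl divff ?gt_eqF// mul1r addrC subrK.
have Lu0 : (dist_Lnorm p u = 0)%E.
  by apply/eqP; rewrite eq_le dist_Lnorm_ge0// andbT -u0 dist_Lnorm_le_pnorm.
have fC := testfun_Lnorm_fin phi q0.
have [C0 CE] : 0 <= fine (Lnorm (rV_lebesgue n) (p / (p - 1))%:E (EFin \o phi)) /\
  Lnorm (rV_lebesgue n) (p / (p - 1))%:E (EFin \o phi) =
    (fine (Lnorm (rV_lebesgue n) (p / (p - 1))%:E (EFin \o phi)))%:E.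
  by rewrite fineK// fine_ge0 ?Lnorm_ge0.
move: (fine _) C0 CE => C C0 CE.
apply/eqP; rewrite -normr_le0; apply/ler_addgt0Pr => e e0; rewrite add0r.
have eC : (dist_Lnorm p u < (e / (C + 1))%:E)%E.
  by rewrite Lu0 lte_fin divr_gt0// ltr_wpDl.
have [_ [f fu <-] fe] := ereal_inf_lt eC.
have := represents_bound phi p0 q0 pq fu; rewrite CE => h.
rewrite -lee_fin; apply: le_trans h _.
apply: (@le_trans _ _ ((e / (C + 1))%:E * C%:E)%E); first by rewrite lee_wpmul2r ?lee_fin// ltW.
rewrite -EFinM lee_fin mulrAC ler_pdivrMr ?ltr_wpDl// ler_wpM2l ?ltW//.
by rewrite ltrDl.
Qed.

End testfun_integrals.

(** * Integration by parts *)

Section integral_of_derivative.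
Context {R : realType}.

(** The integral over the line is one over [-r-1, r+1], and h vanishes at both ends. *)
Lemma integral_derivative_eq0 (h dh : R -> R) (r : R) : 0 <= r ->
  (forall t : R, is_derive t 1 h (dh t)) -> continuous dh ->
  (forall t, r < `|t| -> h t = 0) ->
  (\int[lebesgue_measure]_t (dh t)%:E = 0)%E.
Proof.
move=> r0 hd cdh hr; pose a := r + 1.
have dh0 t : r < `|t| -> dh t = 0.
  move=> rt; have [_ <-] := hd t.
  rewrite (@near_eq_derive R R R h (cst 0)) ?derive_cst//.
  have : \forall y \near t, r < `|y|.
    by have /cvgr_gt := @norm_continuous R R t; apply.
  by apply: filterS => y /hr.
have ch : continuous h.
  move=> t; apply: differentiable_continuous; apply/derivable1_diffP.
  by have [] := hd t.
have ab : - a < a by rewrite /a; lra.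
transitivity (\int[lebesgue_measure]_(t in `[(- a)%R, a]) (dh t)%:E)%E.
  rewrite [RHS]integral_mkcond; apply: eq_integral => t _.
  rewrite /patch; case: ifPn => //; rewrite notin_setE/= in_itv/= => /negP nt.
  rewrite dh0// ltNge; apply: contra nt; rewrite ler_norml /a => /andP[? ?].
  by apply/andP; split; lra.
rewrite (@continuous_FTC2 _ dh h (- a) a)//.
- rewrite !hr ?subee// /a ?normrN ger0_norm; lra.
- exact: continuous_subspaceT.
- split; first by move=> t _; have [] := hd t.
    by apply: cvg_at_right_filter; exact: ch.
  by apply: cvg_at_left_filter; exact: ch.
- by move=> t _; rewrite derive1E; have [_ ->] := hd t.
Qed.

End integral_of_derivative.

Section integral_of_partial.
Context {R : realType}.

Lemma integrable_continuous_cbox n (f : 'rV[R]_n -> R) r : 0 <= r -> continuous f ->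
  (forall x, ~ cbox 0 r x -> f x = 0) ->
  (rV_lebesgue n).-integrable setT (EFin \o f).
Proof.
move=> r0 cf fr; have mf := measurable_continuous_rV cf.
have sf : supp f `<=` cbox 0 r by apply: supp_subset => //; exact: closed_cbox.
have cs : compact (supp f).
  by apply: subclosed_compact (@compact_cbox R n 0 r) sf; exact: closed_closure.
have [M [_ [_ _ fM _]]] := continuous_compact_supp_bounded cf cs.
apply/integrableP; split; first exact/measurable_EFinP.
apply: le_lt_trans (ltry (M `^ 1 * (2 * r) ^+ n)).
apply: le_trans (integral_powR_le mf r0 ltr01 fM fr).
by under [leRHS]eq_integral => x _ do rewrite powRr1//.
Qed.

Lemma rV_consE n (t : R) (y : 'rV[R]_n) :
  rV_cons (t, y) = t *: (delta_mx 0 ord0 : 'rV[R]_n.+1) + rV_cons (0, y).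
Proof.
apply/rowP => i; rewrite !mxE/=; case: (unliftP ord0 i) => [j|] ->/=.
  by rewrite mulr0 add0r.
by rewrite mulr1 addr0.
Qed.

Lemma rV_cons_line n (j : 'I_n) (a t : R) (y : 'rV[R]_n) :
  rV_cons (a, t *: (delta_mx 0 j : 'rV[R]_n) + y) =
  t *: (delta_mx 0 (lift ord0 j) : 'rV[R]_n.+1) + rV_cons (a, y).
Proof.
apply/rowP => i; rewrite !mxE/=; case: (unliftP ord0 i) => [k|] ->/=.
  by rewrite !mxE/= (inj_eq lift_inj).
by rewrite mulr0 add0r.
Qed.

Lemma continuous_rV_cons n (y : 'rV[R]_n) : continuous (fun t : R => rV_cons (t, y)).
Proof.
move=> t; rewrite (_ : (fun t => _) = (fun t : R =>
    t *: (delta_mx 0 ord0 : 'rV[R]_n.+1) + rV_cons (0, y))).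
  by apply: cvgD; [apply: cvgZr_tmp; exact: cvg_id|exact: cvg_cst].
by apply/funext => s; exact: rV_consE.
Qed.

Lemma continuous_rV_cons2 n (a : R) : continuous (fun y : 'rV[R]_n => rV_cons (a, y)).
Proof.
suff H (y : 'rV[R]_n) : (fun y => rV_cons (a, y)) z @[z --> y] --> rV_cons (a, y).
  by move=> y; exact: H.
apply/(@cvgrPdist_lt _ _ _ (nbhs y)) => e e0; near=> z.
rewrite (_ : rV_cons (a, y) - rV_cons (a, z) = rV_cons (0, y - z)); last first.
  apply/rowP => i; rewrite !mxE/=; case: (unliftP ord0 i) => [k|] _/=.
    by rewrite !mxE.
  by rewrite subrr.
rewrite [ltLHS]/Num.norm/= mx_normrE; apply/bigmax_ltP; split=> // -[i j] _.
rewrite (ord1 i) mxE/=; case: (unliftP ord0 j) => [k|] _/=; last by rewrite normr0.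
apply: le_lt_trans (entry_le_norm _ _) _.
by near: z; have /cvgrPdist_lt := @cvg_id _ (nbhs y); apply.
Unshelve. all: by end_near.
Qed.

(** Induction on the dimension, splitting off the first coordinate as the measure
    does.  The derivative along that coordinate is integrated first, by the
    one-variable case; for any other direction the first coordinate is frozen and
    the induction hypothesis applies to the slice. *)
Lemma integral_partial_eq0 n (i : 'I_n) (g : 'rV[R]_n -> R) r : 0 <= r ->
  (forall x, derivable g x (delta_mx 0 i : 'rV[R]_n)) -> continuous (partial i g) ->
  (forall x, ~ cbox 0 r x -> g x = 0) ->
  (\int[rV_lebesgue n]_x (partial i g x)%:E = 0)%E.
Proof.
elim: n i g => [[]//|n IH] i g r0 dg cdg gr.
have sg : supp g `<=` cbox 0 r by apply: supp_subset => //; exact: closed_cbox.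
have dgr x : ~ cbox 0 r x -> partial i g x = 0.
  by move=> nx; apply: supp0 => /supp_partial/sg.
have ig := integrable_continuous_cbox r0 cdg dgr.
have mg : measurable_fun setT (EFin \o partial i g).
  by apply/measurable_EFinP; exact: measurable_continuous_rV.
have ic : (lebesgue_measure \x rV_lebesgue n)%E.-integrable setT
    ((EFin \o partial i g) \o @rV_cons R n).
  apply/integrableP; split; first exact: (measurableT_comp mg (@measurable_rV_cons R n)).
  have /integrableP[_] := ig.
  rewrite [X in (X < _)%E -> _](_ : _ =
    \int[pushforward (lebesgue_measure \x rV_lebesgue n)%E (@rV_cons R n)]_x
      `|(partial i g x)%:E|)%E//.
  rewrite (ge0_integral_pushforward (@measurable_rV_cons R n))//.
  exact: measurableT_comp.
transitivity (\int[lebesgue_measure \x rV_lebesgue n]_z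
    ((EFin \o partial i g) \o @rV_cons R n) z)%E.
  by rewrite -[RHS](integral_pushforward (@measurable_rV_cons R n) mg _ measurableT).
have dline x : is_derive x (delta_mx 0 i : 'rV[R]_n.+1) g (partial i g x).
  exact/derivableP.
move: cdg ic dline; case: (unliftP ord0 i) => [j|] -> cdg ic dline.
  rewrite -integral12_prod_meas1//. apply: integral0_eq => a _.
  rewrite /fubini_F/=.
  have dga y : is_derive y (delta_mx 0 j : 'rV[R]_n) (fun y => g (rV_cons (a, y)))
      (partial (lift ord0 j) g (rV_cons (a, y))).
    rewrite -[y]add0r -(scale0r (delta_mx 0 j)); apply/is_derive_line.
    under eq_fun do rewrite rV_cons_line.
    by apply/is_derive_line; rewrite !scale0r !add0r; exact: dline.
  have E : (fun y => partial (lift ord0 j) g (rV_cons (a, y))) =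
           partial j (fun y => g (rV_cons (a, y))).
    by apply/funext => y; rewrite [RHS]/partial; have [_ ->] := dga y.
  under eq_integral => y _.
    rewrite (_ : partial (lift ord0 j) g (rV_cons (a, y)) =
      partial j (fun y => g (rV_cons (a, y))) y); first over.
    by rewrite -E.
  apply: (IH j (fun y => g (rV_cons (a, y)))) => //.
  - rewrite -E => y; apply: continuous_comp; first exact: continuous_rV_cons2.
    exact: cdg.
  - move=> y ny; apply: gr => yc; apply: ny => k.
    by have := yc (lift ord0 k); rewrite !mxE liftK.
rewrite -integral21_prod_meas1//; apply: integral0_eq => y _.
rewrite /fubini_G/=.
apply: (@integral_derivative_eq0 _ (fun t => g (rV_cons (t, y))) _ r) => //.
- move=> t; rewrite rV_consE.
  under eq_fun do rewrite rV_consE.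
  by apply/is_derive_line; exact: dline.
- by move=> t; apply: continuous_comp; [exact: continuous_rV_cons|exact: cdg].
- move=> t rt; apply: gr => /(_ ord0); rewrite !mxE unlift_none/= subr0.
  by rewrite leNgt rt.
Qed.

End integral_of_partial.

Section testfun_distributions.
Context {R : realType} {n : nat} (Omega : set 'rV[R]_n).
Hypothesis oO : open Omega.
Implicit Types (phi psi chi : testfun Omega) (u v : testfun Omega -> R).

Let mO : measurable Omega := measurable_open_rV oO.

Lemma testfun_derivable phi i x : derivable phi x (delta_mx 0 i : 'rV[R]_n).
Proof. by have [s _ _] := testfunP phi; have [_ /(_ i)[]] := s 1%N. Qed.

Lemma integral_testfun_partial phi i :
  \int[rV_lebesgue n]_(x in Omega) testfun_partial i phi x = 0.
Proof.
have [M [r [_ r0 _ sr]]] := testfun_bounded phi.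
rewrite /Rintegral [X in fine X](_ : _ = 0%E)//.
rewrite integral_mkcond.
rewrite (eq_integral (fun x => (partial i phi x)%:E)); last first.
  move=> x _; rewrite /patch; case: ifPn => //; rewrite notin_setE => nO.
  by rewrite -[partial i phi]/(testfun_partial i phi : _ -> _) testfun_out.
apply: (integral_partial_eq0 r0).
- exact: testfun_derivable.
- exact: (@testfun_continuous _ _ _ (testfun_partial i phi)).
- by move=> x nx; apply: supp0 => /sr.
Qed.

(** The integral of the partial derivative of phi psi vanishes. *)
Lemma integration_by_parts_testfun phi psi i :
  \int[rV_lebesgue n]_(x in Omega) (phi x * testfun_partial i psi x) =
  - \int[rV_lebesgue n]_(x in Omega) (testfun_partial i phi x * psi x).
Proof.
apply/eqP; rewrite -addr_eq0 -RintegralD//; last 2 first.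
- exact: (integrable_testfun_on oO (testfun_mul phi (testfun_partial i psi))).
- exact: (integrable_testfun_on oO (testfun_mul (testfun_partial i phi) psi)).
rewrite -(integral_testfun_partial (testfun_mul phi psi) i); apply/eqP.
apply: eq_Rintegral => x _.
rewrite [RHS](_ : _ = 'D_(delta_mx 0 i : 'rV[R]_n) ((phi : 'rV[R]_n -> R) * psi) x)//.
rewrite deriveM; [|exact: testfun_derivable..].
by rewrite /GRing.scale/= [X in _ = _ + X]mulrC.
Qed.

Lemma dist_of_partial_iter phi i m psi :
  dist_of phi (iter m (testfun_partial i) psi) =
  (-1) ^+ m * dist_of (iter m (testfun_partial i) phi) psi.
Proof.
elim: m phi => [|m IH] phi; first by rewrite mul1r.
rewrite /= [LHS]integration_by_parts_testfun -[X in - X]/(dist_of _ _) IH.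
by rewrite -iterSr exprS mulN1r mulNr.
Qed.

(** Moving the derivatives over one at a time reverses their order, so chi is an
    iterated derivative of phi in the opposite order. *)
Lemma dist_pderiv_dist_of nu phi :
  exists chi, dist_pderiv nu (dist_of phi) = dist_of chi.
Proof.
suff H (s : seq 'I_n) : exists chi, forall psi,
    (-1) ^+ (\sum_(i <- s) nu i)%N *
    dist_of phi (foldr (fun i => iter (nu i) (testfun_partial i)) psi s) = dist_of chi psi.
  have [chi E] := H (enum 'I_n); exists chi; apply/funext => psi.
  by rewrite -E /dist_pderiv /morder big_enum.
elim: s phi => [|i s IH] phi.
  by exists phi => psi; rewrite big_nil expr0 mul1r.
have [chi E] := IH (iter (nu i) (testfun_partial i) phi).
exists chi => psi; rewrite big_cons /= dist_of_partial_iter -E exprD.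
by rewrite mulrACA -expr2 sqrr_sign mul1r.
Qed.

Lemma represents_dist_of chi : represents chi (dist_of chi).
Proof.
split; first by apply: measurable_funS (testfun_measurable chi).
move=> phi; split=> //.
exact: (integrable_testfun_on oO (testfun_mul chi phi)).
Qed.

Lemma dist_ofZ c phi : dist_of (c *: phi) = c *: dist_of phi.
Proof.
apply/funext => psi; rewrite [RHS](_ : _ = c * dist_of phi psi)// /dist_of.
rewrite -RintegralZl//; last first.
  exact: (integrable_testfun_on oO (testfun_mul phi psi)).
by apply: eq_Rintegral => x _; rewrite mulrA.
Qed.

Lemma testfun_sup_ge psi x : `|psi x| <= sup (range (fun x => `|psi x|)).
Proof.
have [M [r [_ _ psiM _]]] := testfun_bounded psi.
apply: ub_le_sup; last by exists x.
by exists M => _ [y _ <-].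
Qed.

Lemma sup_le_Ck_norm0 psi : sup (range (fun x => `|psi x|)) <= Ck_norm 0 psi.
Proof.
pose nu0 : mindex n 0 := [ffun=> ord0].
have m0 : morder nu0 = 0%N by rewrite /morder big1// => i _; rewrite /mindex_fun ffunE.
rewrite /Ck_norm (bigD1 nu0) ?m0//=.
rewrite (_ : testfun_pderiv nu0 psi = psi).
  rewrite lerDl sumr_ge0// => nu _.
  exact: (le_trans (normr_ge0 _) (testfun_sup_ge (testfun_pderiv (nu : mindex n 0) psi) 0)).
rewrite /testfun_pderiv; elim: (enum 'I_n) => //= i s ->.
by rewrite /mindex_fun ffunE.
Qed.

(** The bound |u psi| <= ||phi||_1 sup |psi| holds on every compact set. *)
Lemma is_distribution_dist_of phi : is_distribution (dist_of phi).
Proof.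
split=> [a psi chi|K cK KO].
  rewrite [RHS](_ : _ = a * dist_of phi psi + dist_of phi chi)// /dist_of.
  have ip eta := integrable_testfun_on oO (testfun_mul phi eta).
  rewrite -RintegralZl; [|exact: mO|exact: ip].
  rewrite -RintegralD; [|exact: mO| |exact: ip].
    apply: eq_Rintegral => x _.
    transitivity (phi x * (a * psi x + chi x)) => //=.
    by ring.
  apply: (eq_integrable mO) (integrableZl mO a (ip psi)) => x _ /=.
  by rewrite -EFinM.
exists (\int[rV_lebesgue n]_(x in Omega) `|phi x|), 0%N => psi _.
apply: (@le_trans _ _ (\int[rV_lebesgue n]_(x in Omega) `|phi x| *
    sup (range (fun x => `|psi x|)))).
  rewrite mulrC -RintegralZl//; last first.
    exact: (integrable_norm (integrable_testfun_on oO phi)).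
  apply: le_trans (le_normr_Rintegral mO _) _.
    exact: (integrable_testfun_on oO (testfun_mul phi psi)).
  apply: le_Rintegral => //.
  - exact: (integrable_norm (integrable_testfun_on oO (testfun_mul phi psi))).
  - apply: (eq_integrable mO) (integrableZl mO (sup (range (fun x => `|psi x|)))
      (integrable_norm (integrable_testfun_on oO phi))) => x _ /=.
    by rewrite -EFinM.
  by move=> x _; rewrite normrM mulrC ler_wpM2r// testfun_sup_ge.
rewrite ler_wpM2l ?sup_le_Ck_norm0//.
by apply: Rintegral_ge0.
Qed.

End testfun_distributions.

(** * Test functions have finite Slobodeckij seminorm *)

Section lipschitz.
Context {R : realType}.

Lemma bounded_derivative_lipschitz (h dh : R -> R) (M a b : R) :
  (forall t : R, is_derive t 1 h (dh t)) -> (forall t, `|dh t| <= M) ->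
  `|h b - h a| <= M * `|b - a|.
Proof.
move=> hd dM; wlog ab : a b / a <= b.
  move=> H; have [/H//|/ltW/H] := leP a b.
  by rewrite distrC [X in _ <= _ * X]distrC.
have [c _ ->] : exists2 c, c \in `[a, b]%R & h b - h a = dh c * (b - a).
  apply: MVT_segment => //; apply: continuous_subspaceT => t.
  apply: differentiable_continuous; apply/derivable1_diffP.
  by have [] := hd t.
by rewrite normrM ler_wpM2r.
Qed.

Context {n : nat} (Omega : set 'rV[R]_n).
Implicit Types phi : testfun Omega.

(** Walk from x to y by changing one coordinate at a time; the mean value theorem
    bounds each step by a bound on one partial derivative. *)
Lemma testfun_lipschitz phi :
  exists2 L, 0 <= L & forall x y, `|phi x - phi y| <= L * `|x - y|.
Proof.
have /choice[M MP] (i : 'I_n) : exists M, 0 <= M /\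
    forall x, `|testfun_partial i phi x| <= M.
  by have [M [_ [M0 _ + _]]] := testfun_bounded (testfun_partial i phi); exists M.
exists (\sum_i M i); first by rewrite sumr_ge0// => i _; case: (MP i).
move=> x y; pose z k : 'rV[R]_n := \row_i (if (i < k)%N then y 0 i else x 0 i).
have z0 : z 0%N = x by apply/rowP => i; rewrite mxE.
have zn : z n = y by apply/rowP => i; rewrite mxE ltn_ord.
rewrite distrC -[in phi y]zn -[in X in _ - X]z0 -(telescope_sumr (fun k => phi (z k)))//.
rewrite big_mkord mulr_suml; apply: le_trans (ler_norm_sum _ _ _) _.
apply: ler_sum => i _; have [M0 iM] := MP i.
have zS : z i.+1 = (y 0 i - x 0 i) *: (delta_mx 0 i : 'rV[R]_n) + z i.
  apply/rowP => j; rewrite !mxE eqxx/= ltnS leq_eqVlt (inj_eq val_inj).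
  have [->|ji] := eqVneq j i; first by rewrite ltnn mulr1 subrK.
  by rewrite mulr0 add0r.
have := @bounded_derivative_lipschitz
  (fun t => phi (t *: (delta_mx 0 i : 'rV[R]_n) + z i))
  (fun t => testfun_partial i phi (t *: (delta_mx 0 i : 'rV[R]_n) + z i))
  (M i) 0 (y 0 i - x 0 i).
rewrite -zS scale0r add0r subr0 => h; apply: le_trans (h _ _) _.
- move=> t; apply/is_derive_line; apply/derivableP; exact: testfun_derivable.
- by move=> t; exact: iM.
rewrite ler_wpM2l// distrC.
by have := entry_le_norm (x - y) i; rewrite !mxE.
Qed.

End lipschitz.

Section dyadic.
Context {R : realType}.

Lemma powR_exprn (a s : R) k : 0 <= a -> (a ^+ k) `^ s = (a `^ s) ^+ k.
Proof.
move=> a0; rewrite -!powR_mulrn ?powR_ge0// -!powRrM mulrC//.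
Qed.

Lemma natr_le_expr2 k : k%:R <= 2 ^+ k :> R.
Proof. by rewrite -natrX ler_nat ltnW// ltn_expl. Qed.

Lemma dyadic_large (rho : R) : 1 < rho -> exists k, 2 ^+ k < rho <= 2 ^+ k.+1.
Proof.
move=> rho1; have rho0 := lt_trans ltr01 rho1.
have ex : exists k, rho <= 2 ^+ k.+1.
  exists (Num.truncn rho); apply: le_trans (natr_le_expr2 _).
  exact/ltW/truncnS_gt.
have [k rk kmin] := ex_minnP ex; exists k; rewrite rk andbT.
case: k rk kmin => [|k] rk kmin; first by rewrite expr0.
by rewrite ltNge; apply/negP => /kmin; rewrite ltnn.
Qed.

Lemma dyadic_small (rho : R) : 0 < rho -> rho <= 1 ->
  exists k, 2^-1 ^+ k.+1 < rho <= 2^-1 ^+ k.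
Proof.
move=> rho0 rho1.
have ex : exists k, 2^-1 ^+ k.+1 < rho.
  exists (Num.truncn rho^-1); rewrite exprVn invf_plt ?posrE ?exprn_gt0//.
  apply: lt_le_trans (natr_le_expr2 _).
  exact: truncnS_gt.
have [k rk kmin] := ex_minnP ex; exists k; rewrite rk/=.
case: k rk kmin => [|k] rk kmin; first by rewrite expr0.
by rewrite leNgt; apply/negP => /kmin; rewrite ltnn.
Qed.

Local Open Scope ereal_scope.

(** If one of the functions g_k dominates K at each point, then K is at most their
    sum, whose integral is bounded by a geometric series. *)
Lemma integral_lty_of_cover d (T : measurableType d)
    (mu : {measure set T -> \bar R}) (K : T -> \bar R) (g : nat -> T -> \bar R)
    (C z : R) :
  measurable_fun setT K -> (forall x, 0 <= K x) ->
  (forall k, measurable_fun setT (g k)) -> (forall k x, 0 <= g k x) ->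
  (forall x, exists k, K x <= g k x) ->
  (0 <= C)%R -> (0 <= z < 1)%R ->
  (forall k, \int[mu]_x g k x <= (C * z ^+ k)%:E) ->
  \int[mu]_x K x < +oo.
Proof.
move=> mK K0 mg g0 Kg C0 /andP[z0 z1] gC.
apply: (@le_lt_trans _ _ (\int[mu]_x \sum_(0 <= k <oo) g k x)).
  apply: ge0_le_integral => //.
    exact: ge0_emeasurable_sum.
  move=> x _; have [k Kk] := Kg x; apply: le_trans Kk _.
  apply: le_trans (nneseries_lim_ge k.+1 _) => //.
  by rewrite big_nat_recr//= leeDr// sume_ge0.
rewrite integral_nneseries//.
apply: (@le_lt_trans _ _ (\sum_(0 <= k <oo) (C * z ^+ k)%:E)).
  by apply: lee_nneseries => // k _ _; exact: integral_ge0.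
have z1' : (`|z| < 1)%R by rewrite ger0_norm.
have /cvg_lim E := @cvg_geometric_series R C z z1'.
rewrite (_ : \sum_(0 <= k <oo) (C * z ^+ k)%:E = (C / (1 - z))%:E) ?ltry//.
rewrite -E// -EFin_lim; last exact: is_cvg_geometric_series.
by apply: congr_lim; apply/funext => k /=; rewrite /series/= sumEFin.
Qed.

End dyadic.

Section strips.
Context {R : realType} {n : nat}.
Notation T := ('rV[R]_n * 'rV[R]_n)%type.
Notation mu := (@rV_lebesgue R n).

(** The pairs (x, y) at distance at most rho in every coordinate, with x in the box
    of radius r around 0; the swapped version asks this of y. *)
Definition strip (r rho : R) : set T :=
  [set z | cbox 0 r z.1 /\ cbox 0 rho (z.2 - z.1)].

Definition strip_swap (r rho : R) : set T :=
  [set z | cbox 0 r z.2 /\ cbox 0 rho (z.1 - z.2)].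

Let measurable_sub (a b : T -> 'rV[R]_n) :
  measurable_fun setT a -> measurable_fun setT b -> measurable_fun setT (a - b).
Proof.
move=> ma mb; apply: measurable_fun_rV => i.
rewrite (_ : _ \o _ = (@rV_coord R n i \o a) \- (@rV_coord R n i \o b)).
  by apply: measurable_funB; apply: (measurableT_comp (measurable_rV_coord i)).
by apply/funext => z /=; rewrite /rV_coord !mxE.
Qed.

Lemma measurable_strip r rho : measurable (strip r rho).
Proof.
apply: measurableI.
  rewrite -[X in measurable X]setTI.
  by apply: measurable_fst => //; exact: measurable_cbox.
rewrite -[X in measurable X]setTI.
by apply: (measurable_sub measurable_snd measurable_fst) => //; exact: measurable_cbox.
Qed.

Lemma measurable_strip_swap r rho : measurable (strip_swap r rho).
Proof.
apply: measurableI.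
  rewrite -[X in measurable X]setTI.
  by apply: measurable_snd => //; exact: measurable_cbox.
rewrite -[X in measurable X]setTI.
by apply: (measurable_sub measurable_fst measurable_snd) => //; exact: measurable_cbox.
Qed.

Lemma cbox_sub (x y : 'rV[R]_n) rho : cbox 0 rho (y - x) <-> cbox x rho y.
Proof. by split=> h i; have := h i; rewrite !mxE subr0. Qed.

Let integral_indic_cbox r rho : 0 <= r -> 0 <= rho ->
  (\int[mu]_x (((2 * rho) ^+ n)%:E * (\1_(cbox 0 r) x)%:E) =
   ((2 * r) ^+ n * (2 * rho) ^+ n)%:E)%E.
Proof.
move=> r0 rho0; rewrite ge0_integralZl//.
- rewrite integral_indic// ?setIT; last exact: measurable_cbox.
  by rewrite muleC EFinM -(rV_lebesgue_cbox (0 : 'rV[R]_n) r0).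
- by apply/measurable_EFinP; apply: measurable_indic; exact: measurable_cbox.
- by rewrite lee_fin exprn_ge0// mulr_ge0.
Qed.

(** Each section over x in the box is a box of radius rho around x. *)
Lemma product_measure_strip r rho : 0 <= r -> 0 <= rho ->
  (mu \x mu)%E (strip r rho) = ((2 * r) ^+ n * (2 * rho) ^+ n)%:E.
Proof.
move=> r0 rho0; rewrite -integral_indic_cbox//.
rewrite /product_measure1; apply: eq_integral => x _ /=.
rewrite indicE; have [xr|nxr] := pselect (cbox 0 r x).
  rewrite mem_set// mule1 -(rV_lebesgue_cbox x rho0); congr (rV_lebesgue n _).
  apply/seteqP; split=> y; rewrite /xsection/= inE; first by case=> _ /cbox_sub.
  by move=> /cbox_sub ?; split.
rewrite memNset// mule0 (_ : xsection _ _ = set0) ?measure0//.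
by apply/seteqP; split=> y //; rewrite /xsection/= inE => -[].
Qed.

(** Sections are now taken over y, which computes the same product measure by
    uniqueness. *)
Lemma product_measure_strip_swap r rho : 0 <= r -> 0 <= rho ->
  (mu \x mu)%E (strip_swap r rho) = ((2 * r) ^+ n * (2 * rho) ^+ n)%:E.
Proof.
move=> r0 rho0; rewrite -integral_indic_cbox//.
rewrite (@product_measure_unique _ _ _ _ _ mu mu (mu \x^ mu)%E); last 2 first.
- by move=> A B mA mB; exact: (@product_measure2E _ _ _ _ _ mu mu A B mA mB).
- exact: measurable_strip_swap.
rewrite /= /product_measure2; apply: eq_integral => y _ /=.
rewrite indicE; have [xr|nxr] := pselect (cbox 0 r y).
  rewrite mem_set// mule1 -(rV_lebesgue_cbox y rho0); congr (rV_lebesgue n _).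
  apply/seteqP; split=> x; rewrite /ysection/= inE; first by case=> _ /cbox_sub.
  by move=> /cbox_sub ?; split.
rewrite memNset// mule0 (_ : ysection _ _ = set0) ?measure0//.
by apply/seteqP; split=> x //; rewrite /ysection/= inE => -[].
Qed.

Definition strips r rho (z : T) : R := \1_(strip r rho) z + \1_(strip_swap r rho) z.

Lemma strips_ge0 r rho z : 0 <= strips r rho z.
Proof. by rewrite addr_ge0. Qed.

Lemma measurable_strips r rho : measurable_fun setT (strips r rho).
Proof.
by apply: measurable_funD; apply: measurable_indic;
  [exact: measurable_strip|exact: measurable_strip_swap].
Qed.

Lemma integral_strips r rho : 0 <= r -> 0 <= rho ->
  (\int[mu \x mu]_z (strips r rho z)%:E = (2 * (2 * r) ^+ n * (2 * rho) ^+ n)%:E)%E.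
Proof.
move=> r0 rho0; under eq_integral => z _ do rewrite EFinD.
rewrite ge0_integralD//; last 2 first.
- by apply/measurable_EFinP; apply: measurable_indic; exact: measurable_strip.
- by apply/measurable_EFinP; apply: measurable_indic; exact: measurable_strip_swap.
rewrite !integral_indic// ?setIT;
  [|exact: measurable_strip_swap|exact: measurable_strip].
rewrite [X in (X + _)%E](product_measure_strip r0 rho0).
rewrite [X in (_ + X)%E](product_measure_strip_swap r0 rho0).
by rewrite -EFinD; congr EFin; ring.
Qed.

Lemma norm_cbox (x : 'rV[R]_n) rho : `|x| <= rho -> cbox 0 rho x.
Proof. by move=> xr i; rewrite mxE subr0; exact: le_trans (entry_le_norm x i) xr. Qed.

Lemma strips_ge1 r rho x y : cbox 0 r x \/ cbox 0 r y -> `|x - y| <= rho ->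
  1 <= strips r rho (x, y).
Proof.
move=> xyr xy; rewrite /strips !indicE; case: xyr => [xr|yr].
  rewrite (mem_set (_ : strip r rho (x, y))) ?lerDl//.
  by split=> //=; apply: norm_cbox; rewrite distrC.
rewrite (mem_set (_ : strip_swap r rho (x, y))) ?lerDr//.
by split=> //=; exact: norm_cbox.
Qed.

Lemma norm_le_eucl_norm (x : 'rV[R]_n) : `|x| <= eucl_norm x.
Proof.
rewrite [leLHS]/Num.norm/= mx_normrE; apply/bigmax_leP; split=> [|[i j] _].
  exact: sqrtr_ge0.
rewrite (ord1 i)/= -sqrtr_sqr ler_wsqrtr// (bigD1 j)//= lerDl sumr_ge0// => k _.
exact: sqr_ge0.
Qed.

End strips.

Section testfun_slobodeckij.
Context {R : realType} {n : nat} (Omega : set 'rV[R]_n).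
Hypothesis oO : open Omega.
Implicit Types (phi : testfun Omega) (theta q : R).

Notation mu := (@rV_lebesgue R n).

(** The integrand in the q-th power of the Slobodeckij seminorm, for a = n + theta q. *)
Let kernel phi q a (z : 'rV[R]_n * 'rV[R]_n) : R :=
  `|phi z.1 - phi z.2| `^ q * (eucl_norm (z.1 - z.2) `^ a)^-1.

Let kernel_ge0 phi q a z : 0 <= kernel phi q a z.
Proof. by rewrite mulr_ge0 ?invr_ge0 ?powR_ge0. Qed.

Let measurable_kernel phi q a : measurable_fun setT (kernel phi q a).
Proof.
apply: measurable_funM.
  apply: (measurableT_comp (measurable_powR q)); apply: measurableT_comp => //.
  by apply: measurable_funB; apply: (measurableT_comp (testfun_measurable phi)).
rewrite (_ : (fun z => _) = (fun z => eucl_norm (z.1 - z.2) `^ (- a))).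
  exact: (measurableT_comp (measurable_powR _) measurable_eucl_dist).
by apply/funext => z; rewrite powRN.
Qed.

Let kernel_le phi q a (x y : 'rV[R]_n) (D s : R) : 0 <= q -> 0 <= a -> 0 < s ->
  `|phi x - phi y| <= D -> s <= `|x - y| ->
  kernel phi q a (x, y) <= D `^ q * (s `^ a)^-1.
Proof.
move=> q0 a0 s0 xyD sxy; have D0 := le_trans (normr_ge0 _) xyD.
have se := le_trans sxy (norm_le_eucl_norm _).
rewrite ler_pM ?invr_ge0 ?powR_ge0 ?ge0_ler_powR ?nnegrE//=.
rewrite lef_pV2 ?posrE ?powR_gt0//; last exact: lt_le_trans se.
by rewrite ge0_ler_powR ?nnegrE// ?(ltW s0)// (le_trans (ltW s0) se).
Qed.

Let integral_scaled_strips (c r rho : R) : 0 <= c -> 0 <= r -> 0 <= rho ->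
  (\int[mu \x mu]_z (c * strips r rho z)%:E =
   (c * (2 * (2 * r) ^+ n * (2 * rho) ^+ n))%:E)%E.
Proof.
move=> c0 r0 rho0; under eq_integral do rewrite EFinM.
rewrite ge0_integralZl//.
- by rewrite integral_strips.
- by apply/measurable_EFinP; exact: measurable_strips.
- by move=> z _; rewrite lee_fin strips_ge0.
Qed.

(** The kernel vanishes unless x or y is in a box containing the support.

    Near the diagonal, let h^(k+1) < |x - y| <= h^k with h = 1/2.  The numerator is at
    most (L h^k)^q by the Lipschitz bound, the denominator at least h^((k+1) a), and
    the shell has measure of order h^(k n): with a = n + theta q the product is of
    order h^(k (1 - theta) q).

    Away from it, let 2^k < |x - y| <= 2^(k+1).  The numerator is at most (2 M)^q, the
    denominator at least 2^(k a), and the shell has measure of order 2^(k n): the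
    product is of order 2^(- k theta q). *)
Lemma kernel_integral_fin theta q phi : 0 < theta -> theta < 1 -> 0 < q ->
  (\int[mu \x mu]_z (kernel phi q (n%:R + theta * q) z)%:E < +oo)%E.
Proof.
move=> th0 th1 q0; set a := n%:R + theta * q.
have tq0 : 0 < theta * q by rewrite mulr_gt0.
have a0 : 0 < a by rewrite ltr_wpDl.
have [M [r [M0 r0 phiM sr]]] := testfun_bounded phi.
have [L L0 phiL] := testfun_lipschitz phi.
pose h : R := 2^-1; have h0 : 0 < h by rewrite invr_gt0.
have h1 : h < 1 by rewrite invf_lt1// ltr1n.
(* c and c' bound the kernel on the k-th shell near and away from the diagonal;
   g k adds up these bounds, each on the strips of the width of its shell *)
pose c k := (L * h ^+ k) `^ q * ((h ^+ k.+1) `^ a)^-1.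
pose c' k := (2 * M) `^ q * ((2 ^+ k) `^ a)^-1.
have c0 k : 0 <= c k by rewrite mulr_ge0 ?invr_ge0 ?powR_ge0.
have c'0 k : 0 <= c' k by rewrite mulr_ge0 ?invr_ge0 ?powR_ge0.
pose g k (z : 'rV[R]_n * 'rV[R]_n) :=
    (c k * strips r (h ^+ k) z + c' k * strips r (2 ^+ k.+1) z)%:E.
pose b := h `^ q / h `^ (theta * q); pose b' : R := (2 `^ (theta * q))^-1.
pose A := 2 * (2 * r) ^+ n * 2 ^+ n * L `^ q / h `^ a.
pose A' := 2 * (2 * r) ^+ n * 4 ^+ n * (2 * M) `^ q.
have hk k : 0 < h ^+ k by rewrite exprn_gt0.
have powDn (s : R) : 0 < s -> s `^ a = s ^+ n * s `^ (theta * q).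
  by move=> s0; rewrite powRD ?gt_eqF ?implybT// powR_mulrn// ltW.
(* the integral of g k is A b^k + A' b'^k, with ratios b and b' below 1 *)
have cE k : c k * (2 * (2 * r) ^+ n * (2 * h ^+ k) ^+ n) = A * b ^+ k.
  rewrite /c powRM// ?(ltW (hk k))// !powR_exprn ?(ltW h0)// [(2 * h ^+ k) ^+ n]exprMn.
  rewrite -[(h ^+ k) ^+ n]exprM mulnC exprM.
  rewrite /A /b expr_div_n [in (_ `^ a) ^+ k.+1]exprS.
  rewrite [X in _ / (_ * X ^+ k)](powDn _ h0) exprMn.
  have := hk n; have := powR_gt0 a h0; have := powR_gt0 (theta * q) h0.
  move: (h `^ a) (h `^ (theta * q)) (h ^+ n) => u v w v0 u0 w0.
  have vk : v ^+ k != 0 by rewrite expf_neq0 ?gt_eqF.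
  have wk : w ^+ k != 0 by rewrite expf_neq0 ?gt_eqF.
  move: (v ^+ k) (w ^+ k) vk wk => vk wk vk0 wk0; field.
  by rewrite vk0 wk0 gt_eqF.
have c'E k : c' k * (2 * (2 * r) ^+ n * (2 * 2 ^+ k.+1) ^+ n) = A' * b' ^+ k.
  rewrite /c' powR_exprn// powDn// /A' /b' exprVn exprMn.
  rewrite exprS mulrA (_ : 2 * 2 = 4)%R; last by rewrite -natrM.
  rewrite [(4 * _) ^+ n]exprMn -exprM mulnC exprM.
  have v0 := powR_gt0 (theta * q) (ltr0n R 2).
  by field; rewrite !expf_neq0 ?gt_eqF.
have b0 : 0 <= b by rewrite divr_ge0 ?powR_ge0.
have b'0 : 0 <= b' by rewrite invr_ge0 powR_ge0.
have A0 : 0 <= A by rewrite divr_ge0 ?mulr_ge0 ?powR_ge0 ?exprn_ge0 ?mulr_ge0.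
have A'0 : 0 <= A' by rewrite ?mulr_ge0 ?powR_ge0 ?exprn_ge0 ?mulr_ge0.
have s0 : 0 < q - theta * q by rewrite subr_gt0 gtr_pMl.
have one_powR s : 1 `^ s = 1 :> R by rewrite powR1.
have b1 : b < 1.
  rewrite /b -powRB; last by rewrite (gt_eqF h0) implybT.
  have := gt0_ltr_powR s0; rewrite -[X in _ < X](one_powR (q - theta * q)); apply => //.
  - by rewrite nnegrE ltW.
  - by rewrite nnegrE.
have b'1 : b' < 1.
  rewrite invf_lt1 ?powR_gt0//.
  have := gt0_ltr_powR tq0; rewrite -[X in X < _](one_powR (theta * q)); apply => //.
  - by rewrite nnegrE.
  - by rewrite nnegrE.
  - by rewrite ltr1n.
refine (@integral_lty_of_cover _ _ _ (mu \x mu)%E (EFin \o kernel phi q a) g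
  (A + A') (Num.max b b') _ _ _ _ _ _ _ _).
- apply/measurable_EFinP; exact: measurable_kernel.
- by move=> z; rewrite lee_fin kernel_ge0.
- move=> k; apply/measurable_EFinP; apply: measurable_funD;
    by apply: measurable_funM => //; exact: measurable_strips.
- by move=> k z; rewrite lee_fin addr_ge0// mulr_ge0// strips_ge0.
- move=> [x y].
  have [xy|xy] := eqVneq (phi x) (phi y).
    exists 0%N; rewrite lee_fin /kernel/= xy subrr normr0 powR0 ?gt_eqF// mul0r.
    by rewrite addr_ge0// mulr_ge0// strips_ge0.
  have xyr : cbox 0 r x \/ cbox 0 r y.
    have [x0|x0] := eqVneq (phi x) 0.
      right; apply: sr; apply: contrapT => /supp0 y0.
      by move: xy; rewrite x0 y0 eqxx.
    by left; apply: sr; apply: contrapT => /supp0 /eqP; rewrite (negbTE x0).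
  have rho0 : 0 < `|x - y|.
    by rewrite normr_gt0 subr_eq0; apply: contra_neq xy => ->.
  have [rho1|rho1] := leP `|x - y| 1.
    have [k /andP[k1 k2]] := dyadic_small rho0 rho1.
    exists k; rewrite lee_fin.
    apply: (@le_trans _ _ (c k)).
      apply: kernel_le; rewrite ?(ltW q0) ?(ltW a0) ?(ltW k1)//.
      by apply: le_trans (phiL _ _) _; rewrite ler_wpM2l.
    rewrite -[leLHS]addr0 lerD//; last by rewrite mulr_ge0// strips_ge0.
    by rewrite ler_peMr// strips_ge1.
  have [k /andP[k1 k2]] := dyadic_large rho1.
  exists k; rewrite lee_fin.
  apply: (@le_trans _ _ (c' k)).
    apply: kernel_le; rewrite ?(ltW q0) ?(ltW a0) ?(ltW k1) ?exprn_gt0//.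
    by apply: le_trans (ler_normB _ _) _; rewrite mulr_natl mulr2n lerD.
  rewrite -[leLHS]add0r lerD//; first by rewrite mulr_ge0// strips_ge0.
  by rewrite ler_peMr// strips_ge1.
- by rewrite addr_ge0.
- by rewrite le_max b0/= gt_max b1 b'1.
move=> k; rewrite /g; under eq_integral do rewrite EFinD.
rewrite ge0_integralD//; last 4 first.
- by move=> z _; rewrite lee_fin mulr_ge0// strips_ge0.
- by apply/measurable_EFinP; apply: measurable_funM => //; exact: measurable_strips.
- by move=> z _; rewrite lee_fin mulr_ge0// strips_ge0.
- by apply/measurable_EFinP; apply: measurable_funM => //; exact: measurable_strips.
rewrite !integral_scaled_strips ?exprn_ge0 ?(ltW h0)//.
rewrite cE c'E -EFinD lee_fin mulrDl lerD// ler_wpM2l//.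
  by rewrite lerXn2r ?nnegrE// ?le_max ?b0 ?lexx.
by rewrite lerXn2r ?nnegrE// ?le_max ?b'0 ?lexx ?orbT.
Qed.

Lemma slobodeckij_testfun_lty theta q phi : 0 < theta -> theta < 1 -> 0 < q ->
  (slobodeckij Omega theta q phi < +oo)%E.
Proof.
move=> th0 th1 q0; rewrite /slobodeckij poweR_lty//.
apply: le_lt_trans (kernel_integral_fin phi th0 th1 q0).
have mO := measurable_open_rV oO.
apply: ge0_subset_integral => //; first exact: measurableX.
- by apply/measurable_EFinP; exact: measurable_kernel.
- by move=> z _; rewrite lee_fin kernel_ge0.
Qed.

End testfun_slobodeckij.

(** * A distribution of norm zero vanishes *)

Section separation.
Context {R : realType} {n : nat} (Omega : set 'rV[R]_n).
Hypothesis oO : open Omega.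
Implicit Types (phi : testfun Omega) (u : testfun Omega -> R) (s t p q : R).

Let mO : measurable Omega := measurable_open_rV oO.

Lemma sobolev_pnorm_dist_of_lty t q phi : 0 <= t -> 0 < q ->
  (sobolev_pnorm t q (dist_of phi) < +oo)%E.
Proof.
move=> t0 q0; rewrite /sobolev_pnorm; apply: lte_add_pinfty.
  apply: lte_sum_pinfty => nu _.
  have [chi ->] := dist_pderiv_dist_of oO (mindex_fun nu) phi.
  apply: (@le_lt_trans _ _ (Lnorm (rV_lebesgue n) q%:E (EFin \o (chi \_ Omega)))).
    by apply: ereal_inf_lbound; exists chi => //; exact: represents_dist_of.
  rewrite (_ : chi \_ Omega = chi); last first.
    apply/funext => x; rewrite /patch; case: ifPn => //; rewrite notin_setE => nx.
    by rewrite testfun_out.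
  by rewrite -ge0_fin_numE ?Lnorm_ge0// testfun_Lnorm_fin.
case: ifPn => [_|th]; first exact: ltry.
apply: lte_sum_pinfty => nu _.
have [chi ->] := dist_pderiv_dist_of oO (mindex_fun nu) phi.
apply: (@le_lt_trans _ _ (slobodeckij Omega (t - (Num.truncn t)%:R) q chi)).
  by apply: ereal_inf_lbound; exists chi => //; exact: represents_dist_of.
have /andP[t1 t2] := truncn_itv t0.
apply: slobodeckij_testfun_lty => //.
- by rewrite lt_neqAle eq_sym th subr_ge0.
- by rewrite ltrBlDr -natr1 addrC in t2 *.
Qed.

Lemma sobolev0_dist_of t q phi : 0 <= t -> 0 < q -> sobolev0 Omega t q (dist_of phi).
Proof.
move=> t0 q0; split; first exact: is_distribution_dist_of.
  exact: sobolev_pnorm_dist_of_lty.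
by move=> e e0; exists phi; rewrite subrr sobolev_pnorm0// lte_fin.
Qed.

(** For s < 0, scale phi to norm at most 1 in W^{-s,p'}, which is possible because
    the norm of a test function is finite.  An extension F of u then satisfies
    |u phi| = |F phi| <= ||F||, and ||F|| may be taken arbitrarily small. *)
Lemma sobolev_norm_eq0 s p u : 1 < p -> scalar u -> sobolev_norm s p u = 0%E -> u = 0.
Proof.
move=> p1 lu; rewrite /sobolev_norm; case: ifPn => [_|]; first exact: sobolev_pnorm_eq0.
rewrite -ltNge => s0; set q := p / (p - 1) => u0.
have q0 : 0 < q by exact: lt_trans ltr01 (conj_exponent_gt0 p1).
have t0 : 0 <= - s by rewrite oppr_ge0 ltW.
apply/funext => phi.
have fN : sobolev_pnorm (- s) q (dist_of phi) \is a fin_num.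
  by rewrite ge0_fin_numE ?sobolev_pnorm_ge0// sobolev_pnorm_dist_of_lty.
have [N N0 NE] : exists2 N, 0 <= N & sobolev_pnorm (- s) q (dist_of phi) = N%:E.
  by exists (fine (sobolev_pnorm (- s) q (dist_of phi)));
    [rewrite fine_ge0// sobolev_pnorm_ge0|rewrite fineK].
(* N + 1 rather than N, which may be 0 *)
pose c := (N + 1)^-1; have c0 : 0 < c by rewrite invr_gt0 ltr_wpDl.
have unit : (sobolev_pnorm (- s) q (dist_of (c *: phi)) <= 1)%E.
  rewrite dist_ofZ//; apply: le_trans (sobolev_pnormZ oO _ _ q0 (lt0r_neq0 c0)) _.
  rewrite NE gtr0_norm// -EFinM lee_fin /c mulrC ler_pdivrMr ?ltr_wpDl//.
  by rewrite mul1r lerDl.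
suff : u (c *: phi) = 0.
  have -> : u (c *: phi) = c * u phi.
    have z0 : u 0 = 0.
      have := lu 1 0 0; rewrite scale1r addr0 => h.
      have {h} : u 0 = u 0 + u 0 by rewrite {1}h mul1r.
      by move/eqP; rewrite -subr_eq0 opprD addNKr oppr_eq0 => /eqP.
    by have := lu c phi 0; rewrite addr0 z0 addr0.
  by move/eqP; rewrite mulf_eq0 (gt_eqF c0)/= => /eqP.
apply/eqP; rewrite -normr_le0; apply/ler_addgt0Pr => e e0; rewrite add0r.
have ue : (ereal_inf [set dual_norm (- s) q F | F in [set F |
    linear_on (sobolev0 Omega (- s) q) F /\ forall phi, F (dist_of phi) = u phi]]
    < e%:E)%E by rewrite u0 lte_fin.
have [_ [F [_ Fu] <-] Fe] := ereal_inf_lt ue.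
rewrite -lee_fin; apply: le_trans (ltW Fe); apply: ereal_sup_ubound.
exists (dist_of (c *: phi)); last by rewrite Fu.
by split=> //; exact: sobolev0_dist_of.
Qed.

End separation.

(** * Sums and products of distributions *)

Section distributions.
Context {R : realType} {n : nat} (Omega : set 'rV[R]_n).
Implicit Types (phi psi chi : testfun Omega) (u v w : testfun Omega -> R).

Let Ck_term psi (nu : 'I_n -> nat) : R :=
  sup (range (fun x => `|testfun_pderiv nu psi x|)).

Let Ck_term_ge0 psi nu : 0 <= Ck_term psi nu.
Proof. exact: (le_trans (normr_ge0 _) (testfun_sup_ge (testfun_pderiv nu psi) 0)). Qed.

Lemma Ck_norm_ge0 k psi : 0 <= Ck_norm k psi.
Proof. by apply: sumr_ge0 => nu _; exact: Ck_term_ge0. Qed.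

(** A multi-index bounded by k is one bounded by l after widening its entries.
    This lets two distributions share the order of their seminorm estimates. *)
Lemma Ck_norm_mono k l psi : (k <= l)%N -> Ck_norm k psi <= Ck_norm l psi.
Proof.
move=> kl; have kl1 : (k.+1 <= l.+1)%N by [].
pose f (nu : {ffun 'I_n -> 'I_k.+1}) : {ffun 'I_n -> 'I_l.+1} :=
  [ffun i => widen_ord kl1 (nu i)].
have fE nu : mindex_fun (f nu : mindex n l) = mindex_fun (nu : mindex n k).
  by apply/funext => i; rewrite /mindex_fun ffunE.
have finj : injective f.
  move=> a b /ffunP ab; apply/ffunP => i; apply/val_inj.
  by have := ab i; rewrite !ffunE => /(congr1 val).
rewrite /Ck_norm.
pose P := [set nu : {ffun 'I_n -> 'I_k.+1} | (morder (nu : mindex n k) <= k)%N]%SET.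
rewrite [leLHS](_ : _ =
  \sum_(nu in [set f nu | nu in P]%SET) Ck_term psi (nu : mindex n l)); last first.
  rewrite big_imset/=; last by move=> a b _ _; exact: finj.
  apply: eq_big => [nu|nu _]; first by rewrite finset.inE.
  by rewrite /Ck_term fE.
rewrite big_mkcond [leRHS]big_mkcond; apply: ler_sum => nu _.
case: ifPn => [/imsetP[a + ->]|_]; last by case: ifP => // _; exact: Ck_term_ge0.
rewrite finset.inE => ak; rewrite ifT//.
by rewrite fE (leq_trans ak).
Qed.

Lemma is_distributionD u v : is_distribution u -> is_distribution v ->
  is_distribution (u + v).
Proof.
move=> [lu cu] [lv cv]; split=> [a phi psi|K cK KO].
  by rewrite !addrfctE lu lv/=; ring.
have [C1 [N1 h1]] := cu K cK KO; have [C2 [N2 h2]] := cv K cK KO.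
exists (`|C1| + `|C2|), (maxn N1 N2) => phi sphi.
apply: le_trans (ler_normD _ _) _; rewrite mulrDl.
apply: lerD.
  apply: le_trans (h1 _ sphi) _.
  apply: le_trans (ler_wpM2r (Ck_norm_ge0 _ _) (ler_norm _)) _.
  by rewrite ler_wpM2l// Ck_norm_mono// leq_maxl.
apply: le_trans (h2 _ sphi) _.
apply: le_trans (ler_wpM2r (Ck_norm_ge0 _ _) (ler_norm _)) _.
by rewrite ler_wpM2l// Ck_norm_mono// leq_maxr.
Qed.

Lemma is_distributionN u : is_distribution u -> is_distribution (- u).
Proof.
move=> [lu cu]; split=> [a phi psi|K cK KO].
  by rewrite !opprfctE lu/=; ring.
have [C [N h]] := cu K cK KO; exists C, N => phi sphi.
by rewrite opprfctE normrN; exact: h.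
Qed.

Lemma dist_mulD phi u v : dist_mul phi (u + v) = dist_mul phi u + dist_mul phi v.
Proof. by []. Qed.

Lemma dist_mulN phi u : dist_mul phi (- u) = - dist_mul phi u.
Proof. by []. Qed.

Lemma scalar0 u : scalar u -> u 0 = 0.
Proof.
move=> lu; have := lu 1 0 0; rewrite scale1r addr0 mul1r => /eqP.
by rewrite -subr_eq0 opprD addNKr oppr_eq0 => /eqP.
Qed.

(** A test function supported off supp phi has product 0 with phi. *)
Lemma dist_mul_supp phi u : open Omega -> scalar u ->
  dist_supp (dist_mul phi u) `<=` supp phi.
Proof.
move=> oO lu x [Ox nx]; apply: contrapT => nsx; apply: nx.
exists (Omega `&` ~` supp phi) => //=; split.
- by apply: openI => //; exact/closed_openC/closed_closure.
- exact: subIsetl.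
move=> psi spsi; rewrite /dist_mul (_ : testfun_mul phi psi = 0) ?scalar0//.
apply/val_inj/funext => y; have [py|npy] := pselect (supp psi y).
  have [_ ny] := spsi y py.
  by rewrite /= mulrfctE (supp0 ny) mul0r.
by rewrite /= mulrfctE (supp0 npy) mulr0.
Qed.

Lemma scalar_sum u N (chi : nat -> testfun Omega) : scalar u ->
  u (\sum_(j < N) chi j) = \sum_(j < N) u (chi j).
Proof.
move=> lu.
elim: N => [|N IH]; first by rewrite !big_ord0 scalar0.
by rewrite !big_ord_recr/= -IH addrC -[X in u (X + _)]scale1r lu mul1r addrC.
Qed.

Lemma dist_mul_decomposition psi N (phi chi : nat -> testfun Omega) u : scalar u ->
  psi = \sum_(j < N) testfun_mul (chi j) (phi j) ->
  dist_mul psi u = \sum_(j < N) dist_mul (chi j) (dist_mul (phi j) u).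
Proof.
move=> lu psiE; apply/funext => eta.
have -> : (\sum_(j < N) dist_mul (chi j) (dist_mul (phi j) u)) eta =
    \sum_(j < N) u (testfun_mul (phi j) (testfun_mul (chi j) eta)).
  by elim/big_rec2: _ => // i a f _ <-.
rewrite -(scalar_sum N (fun j => testfun_mul (phi j) (testfun_mul (chi j) eta)) lu).
rewrite /dist_mul; congr u; apply/val_inj/funext => x.
transitivity (psi x * eta x) => //.
rewrite psiE (testfun_sumE N (fun j => testfun_mul (chi j) (phi j))).
rewrite [RHS](testfun_sumE N (fun j => testfun_mul (phi j) (testfun_mul (chi j) eta))).
rewrite mulr_suml; apply: eq_bigr => j _ /=.
by rewrite !mulrfctE; ring.
Qed.

End distributions.

(** * The seminorms of the local space *)

Section local_sobolev.
Context {R : realType} {n : nat} (Omega : set 'rV[R]_n) (s p : R).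
Hypothesis oO : open Omega.
Hypothesis p1 : 1 < p.
Implicit Types (phi psi : testfun Omega) (u v w : testfun Omega -> R).

Lemma sobolev_norm_fin u : sobolev Omega s p u -> sobolev_norm s p u \is a fin_num.
Proof. by move=> [_ ?]; rewrite ge0_fin_numE// sobolev_norm_ge0. Qed.

Lemma sobolevB u v : sobolev Omega s p u -> sobolev Omega s p v ->
  sobolev Omega s p (u - v).
Proof.
move=> [du fu] [dv fv]; split.
  by apply: is_distributionD => //; exact: is_distributionN.
apply: le_lt_trans (sobolev_normD oO s _ _ p1) _; apply: lte_add_pinfty => //.
exact: le_lt_trans (sobolev_normN oO s _ p1) fv.
Qed.

Lemma sobolev_locB u v : sobolev_loc Omega s p u -> sobolev_loc Omega s p v ->
  sobolev_loc Omega s p (u - v).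
Proof.
move=> [du su] [dv sv]; split.
  by apply: is_distributionD => //; exact: is_distributionN.
by move=> phi; rewrite dist_mulD dist_mulN; exact: sobolevB.
Qed.

Lemma loc_seminorm_ge0 phi u : 0 <= loc_seminorm s p phi u.
Proof. by rewrite fine_ge0// sobolev_norm_ge0. Qed.

Lemma loc_seminormE phi u : sobolev_loc Omega s p u ->
  sobolev_norm s p (dist_mul phi u) = (loc_seminorm s p phi u)%:E.
Proof. by move=> [_ su]; rewrite /loc_seminorm fineK// sobolev_norm_fin. Qed.

Lemma loc_seminormD phi u v : sobolev_loc Omega s p u -> sobolev_loc Omega s p v ->
  loc_seminorm s p phi (u + v) <= loc_seminorm s p phi u + loc_seminorm s p phi v.
Proof.
move=> su sv; rewrite -lee_fin EFinD -(loc_seminormE phi su) -(loc_seminormE phi sv).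
have le := sobolev_normD oO s (dist_mul phi u) (dist_mul phi v) p1.
apply: le_trans le; rewrite /loc_seminorm fineK// ge0_fin_numE ?sobolev_norm_ge0//.
apply: le_lt_trans (sobolev_normD oO s (dist_mul phi u) (dist_mul phi v) p1) _.
by rewrite (loc_seminormE phi su) (loc_seminormE phi sv) -EFinD ltry.
Qed.

Lemma loc_seminormN phi u : loc_seminorm s p phi (- u) = loc_seminorm s p phi u.
Proof.
rewrite /loc_seminorm dist_mulN; congr fine; apply/eqP; rewrite eq_le.
rewrite sobolev_normN//=; have := sobolev_normN oO s (- dist_mul phi u) p1.
by rewrite opprK.
Qed.

Lemma loc_seminormC phi u v : loc_seminorm s p phi (u - v) = loc_seminorm s p phi (v - u).
Proof. by rewrite -loc_seminormN opprB. Qed.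

(** For s < 0, the zero functional extends the zero distribution. *)
Lemma sobolev_norm0 : sobolev_norm s p (0 : testfun Omega -> R) = 0%E.
Proof.
apply/eqP; rewrite eq_le sobolev_norm_ge0// andbT /sobolev_norm.
have p0 := lt_trans ltr01 p1; case: ifPn => _; first by rewrite sobolev_pnorm0.
apply: (@le_trans _ _ (dual_norm (- s) (p / (p - 1)) (fun _ : testfun Omega -> R => 0))).
  apply: ereal_inf_lbound; exists (fun=> 0) => //; split=> // a v w _ _.
  by rewrite mulr0 addr0.
by apply: ge_ereal_sup => _ [v _ <-]; rewrite normr0.
Qed.

Lemma loc_seminorm0 phi : loc_seminorm s p phi 0 = 0.
Proof. by rewrite /loc_seminorm (_ : dist_mul phi 0 = 0)// sobolev_norm0. Qed.

Lemma loc_seminorm_triangle phi u v w : sobolev_loc Omega s p u ->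
  sobolev_loc Omega s p v -> sobolev_loc Omega s p w ->
  loc_seminorm s p phi (u - w) <=
  loc_seminorm s p phi (u - v) + loc_seminorm s p phi (v - w).
Proof.
move=> su sv sw; have -> : u - w = (u - v) + (v - w) by rewrite addrA subrK.
by apply: loc_seminormD; exact: sobolev_locB.
Qed.

Variable phi : nat -> testfun Omega.
Hypothesis phi_adm : admissible_family (range phi).

(** Each phi_j w is 0, and by admissible_decomposition every test function is a
    combination of products with the phi_j. *)
Lemma loc_seminorm_separated w : sobolev_loc Omega s p w ->
  (forall j, loc_seminorm s p (phi j) w = 0) -> w = 0.
Proof.
move=> sw w0; have [[lw _] _] := sw.
have {}w0 j : dist_mul (phi j) w = 0.
  apply: (@sobolev_norm_eq0 R n Omega oO s p _ p1).
    by have [_ /(_ (phi j))[[]]] := sw.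
  by rewrite loc_seminormE// w0.
apply/funext => psi.
have [N [chi psiE]] := admissible_decomposition psi phi_adm.
rewrite psiE (scalar_sum N (fun j => testfun_mul (chi j) (phi j)) lw) big1// => j _.
rewrite (_ : testfun_mul _ _ = testfun_mul (phi j) (chi j)); last first.
  by apply/val_inj; rewrite /= mulrC.
by rewrite -[LHS]/(dist_mul (phi j) w (chi j)) w0.
Qed.

Hypothesis triple : interior_smooth_multiplication_triple Omega s p.

(** The products psi w = sum_j chi_j (phi_j w) are estimated termwise, multiplication
    by chi_j being bounded on the elements supported in supp phi_j. *)
Lemma loc_seminorm_bounded psi : exists N (C : nat -> R), (forall j, 0 <= C j) /\
  forall w, sobolev_loc Omega s p w ->
    loc_seminorm s p psi w <= \sum_(j < N) C j * loc_seminorm s p (phi j) w.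
Proof.
have [N [chi psiE]] := admissible_decomposition psi phi_adm.
have /choice[C CP] (j : nat) : exists C : R, 0 <= C /\
    forall w, sobolev_loc Omega s p w ->
    (sobolev_norm s p (dist_mul (chi j) (dist_mul (phi j) w)) <=
     (C * loc_seminorm s p (phi j) w)%:E)%E.
  have [_ cK KO] := testfunP (phi j).
  have [_ [C hC]] := triple (chi j) cK KO.
  exists `|C|; split=> // w sw.
  have sj : sobolev_on (supp (phi j)) s p (dist_mul (phi j) w).
    split; first by case: sw.
    by have [[lw _] _] := sw; exact: dist_mul_supp.
  apply: le_trans (hC _ sj) _; rewrite loc_seminormE// -EFinM lee_fin.
  by rewrite ler_wpM2r ?loc_seminorm_ge0// ler_norm.
exists N, C; split=> [j|w sw]; first by case: (CP j).
have [[lw _] _] := sw.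
rewrite -lee_fin -loc_seminormE// (dist_mul_decomposition lw psiE).
have sum_le m :
    (sobolev_norm s p (\sum_(j < m.+1) dist_mul (chi j) (dist_mul (phi j) w))%R <=
    \sum_(j < m.+1) (C j * loc_seminorm s p (phi j) w)%:E)%E.
  elim: m => [|m IH]; first by rewrite !big_ord1; case: (CP 0%N) => _; exact.
  rewrite big_ord_recr [leRHS]big_ord_recr/=.
  apply: le_trans (sobolev_normD oO s _ _ p1) _; apply: leeD => //.
  by case: (CP m.+1) => _; exact.
case: N psiE => [|N] psiE; last by rewrite -sumEFin; exact: sum_le.
by rewrite !big_ord0 sobolev_norm0.
Qed.

End local_sobolev.

(** * The metric and its topology *)

Section metric.
Context {R : realType} {n : nat} (Omega : set 'rV[R]_n) (s p : R).
Hypothesis oO : open Omega.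
Hypothesis p1 : 1 < p.
Variable phi : nat -> testfun Omega.
Hypothesis phi_adm : admissible_family (range phi).
Hypothesis triple : interior_smooth_multiplication_triple Omega s p.

Notation X := (loc_space Omega s p).
Notation dist := (loc_metric s p phi).
Implicit Types (u v w x y : X).

Let seminorms (f : testfun Omega -> R) : R^nat :=
  fun j => loc_seminorm s p (phi j) f.

Let seminorms_ge0 f j : 0 <= seminorms f j.
Proof. exact: loc_seminorm_ge0. Qed.

Lemma loc_spaceP u : sobolev_loc Omega s p (\val u).
Proof. exact: (set_mem (valP u)). Qed.

Lemma loc_metricE u v : dist u v = frechet (seminorms (\val u - \val v)).
Proof. by []. Qed.

Lemma loc_metric_is_metric : is_metric dist.
Proof.
split=> [u v|u v|u v|u v w].
- by rewrite loc_metricE frechet_ge0.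
- rewrite loc_metricE frechet_eq0//; split=> [uv0|-> j]; last first.
    by rewrite /seminorms subrr loc_seminorm0.
  apply/val_inj/eqP; rewrite -subr_eq0; apply/eqP.
  apply: (@loc_seminorm_separated R n Omega s p oO p1 phi) => //.
  by apply: sobolev_locB => //; exact: loc_spaceP.
- rewrite !loc_metricE; congr frechet; apply/funext => j.
  exact: loc_seminormC.
- rewrite !loc_metricE; apply: frechet_subadd => // j.
  by apply: loc_seminorm_triangle => //; exact: loc_spaceP.
Qed.

Lemma nbhs_seminorm_ball psi u (e : R) : 0 < e ->
  nbhs u [set v : X | loc_seminorm s p psi (\val v - \val u) < e].
Proof.
move=> e0; set B := [set v | _]; rewrite nbhsE; exists B => //; split; last first.
  by rewrite /B/= subrr loc_seminorm0.
exists [set B]; last by rewrite bigcup_set1.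
move=> _ ->; exists [fset B]%fset; last first.
  apply/seteqP; split=> v; first by move/(_ B); apply; rewrite /= in_fset1.
  by move=> Bv C; rewrite /= in_fset1 => /eqP ->.
move=> C; rewrite in_fset1 => /eqP ->.
by apply/mem_set; exists psi, u, e.
Qed.

Lemma nbhs_metric_ball u (e : R) : 0 < e -> nbhs u [set v | dist u v < e].
Proof.
move=> e0; have e20 : 0 < e / 2 by rewrite divr_gt0.
have [N Ne] : exists N, 2^-1 ^+ N < e / 2 :> R.
  exists (Num.truncn (e / 2)^-1).+1; rewrite exprVn invf_plt ?posrE ?exprn_gt0//.
  by apply: lt_le_trans (natr_le_expr2 _); exact: truncnS_gt.
have : nbhs u [set v : X | forall j : 'I_N,
    loc_seminorm s p (phi j) (\val v - \val u) < e / 2].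
  apply: (@filter_forall _ _ (fun (j : 'I_N) (v : X) =>
    loc_seminorm s p (phi j) (\val v - \val u) < e / 2) (nbhs u)) => j.
  exact: nbhs_seminorm_ball.
apply: filterS => v uv /=; rewrite loc_metricE [e]splitr.
apply: le_lt_trans (ler_ltD _ Ne); last exact: lexx.
apply: frechet_le_head => // [|j jN]; first exact: ltW.
by rewrite /seminorms loc_seminormC//; exact/ltW/(uv (Ordinal jN)).
Qed.

(** With S = sum_(j < N) C_j and t = e / (S + 1), it is enough that the first N
    seminorms be below t. *)
Lemma metric_ball_seminorm psi u (e : R) : 0 < e ->
  exists2 r, 0 < r &
    forall v, dist u v < r -> loc_seminorm s p psi (\val v - \val u) < e.
Proof.
move=> e0; have [N [C [C0 hC]]] := loc_seminorm_bounded oO p1 phi_adm triple psi.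
pose S := \sum_(j < N) C j; have S0 : 0 <= S by rewrite sumr_ge0.
pose t := e / (S + 1); have t0 : 0 < t by rewrite divr_gt0// ltr_wpDl.
have tt0 : 0 < t / (1 + t) by rewrite divr_gt0// addr_gt0.
exists (2^-1 ^+ N * (t / (1 + t))); first by rewrite mulr_gt0// exprn_gt0.
move=> v duv.
have small j : (j < N)%N -> loc_seminorm s p (phi j) (\val v - \val u) < t.
  move=> jN; rewrite loc_seminormC//.
  apply: (@frechet_small_term _ (seminorms (\val u - \val v))) => //.
  apply: lt_le_trans duv _; rewrite ler_wpM2r ?(ltW tt0)//.
  by rewrite ler_wiXn2l// ?invr_ge0// invf_le1// ler1n.
apply: le_lt_trans (hC _ _) _.
  by apply: sobolev_locB => //; exact: loc_spaceP.
apply: (@le_lt_trans _ _ (S * t)).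
  rewrite mulr_suml; apply: ler_sum => j _.
  by rewrite ler_wpM2l//; exact/ltW/small.
by rewrite /t mulrA ltr_pdivrMr ?ltr_wpDl// mulrC ltr_pM2l// ltrDl.
Qed.

Lemma metric_ball_filter u :
  Filter (filter_from [set r : R | 0 < r] (fun r => [set v | dist u v < r])).
Proof.
apply: filter_from_filter; first by exists 1 => /=.
move=> a b /= a0 b0; exists (Num.min a b); first by rewrite lt_min a0.
by move=> v /=; rewrite lt_min => /andP[].
Qed.

(** The sets containing a ball around u form a filter, so for the inclusion from left
    to right it suffices to treat one member of the subbase. *)
Lemma nbhs_metricP u (A : set X) : nbhs u A <->
  exists2 r : R, 0 < r & [set v | dist u v < r] `<=` A.
Proof.
split; last by move=> [r r0 rA]; apply: filterS rA _; exact: nbhs_metric_ball.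
rewrite nbhsE => -[_ [[D sD <-] [B DB Bu]] DA].
have F := metric_ball_filter u.
suff : filter_from [set r : R | 0 < r] (fun r => [set v | dist u v < r]) A by [].
apply: (filterS DA); apply: (@filterS _ _ _ B); first by move=> v ?; exists B.
have /sD[E sE EB] := DB; rewrite -EB; apply: filter_bigI => C CE.
have /set_mem [psi [v [e [e0 CE']]]] := sE _ CE.
have : C u by move: Bu; rewrite -EB => /(_ _ CE).
rewrite CE' /= => uv.
have [r r0 rP] := metric_ball_seminorm psi u (ltac:(by rewrite subr_gt0; exact: uv) :
  0 < e - loc_seminorm s p psi (\val u - \val v)).
exists r => // w /rP; rewrite ltrBrDr /= => h.
apply: le_lt_trans h.
by apply: loc_seminorm_triangle => //; exact: loc_spaceP.
Qed.

Lemma loc_metric_compatible : metric_compatible dist.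
Proof.
move=> A; rewrite openE; split=> [Ao x Ax|Ad x Ax].
  by apply/nbhs_metricP; exact: Ao.
by apply/nbhs_metricP; exact: Ad.
Qed.

End metric.

Theorem corollary5p5 (R : realType) (n : nat) (Omega : set 'rV[R]_n) (s p : R)
    (Omega_neq0 : Omega !=set0) (Omega_open : open Omega) (p_gt1 : 1 < p)
    (triple : interior_smooth_multiplication_triple Omega s p) :
  metrizable R (loc_space Omega s p) /\
  forall phi : nat -> testfun Omega, admissible_family (range phi) ->
  [/\ is_metric (loc_metric s p phi),
      forall u v w, sobolev_loc Omega s p u -> sobolev_loc Omega s p v ->
        sobolev_loc Omega s p w ->
        loc_dist s p phi (u + w) (v + w) = loc_dist s p phi u v
    & metric_compatible (loc_metric s p phi)].
Proof.
split=> [|phi adm].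
  have adm := admissible_bump_family Omega_open.
  exists (loc_metric s p (@bump_family R n Omega)); split.
    exact: loc_metric_is_metric.
  exact: loc_metric_compatible.
split; first exact: loc_metric_is_metric.
  by move=> u v w _ _ _; rewrite /loc_dist opprD addrACA subrr addr0.
exact: loc_metric_compatible.
Qed.
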